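(* Let $\Lambda$ be the complement of a linear forest and let $\Gamma$ be a finite simple graph. If there is an injective group homomorphism $A(\Lambda) \hookrightarrow A(\Gamma)$, then $\Lambda \leq \Gamma^e$, i.e. there is a full embedding of $\Lambda$ into the extension graph $\Gamma^e$.
   Context: All graphs are simple. For a graph $\Gamma$, the right-angled Artin group is $A(\Gamma) = \langle V(\Gamma) \mid uv=vu \text{ whenever } \{u,v\}\in E(\Gamma)\rangle$. A graph embedding $\iota\colon \Lambda\to\Gamma$ is an injective map $V(\Lambda)\to V(\Gamma)$ sending adjacent vertices to adjacent vertices; it is full if it also sends non-adjacent vertices to non-adjacent vertices. We write $\Lambda \leq \Gamma$ if there is a full embedding $\Lambda\to\Gamma$. The path graph $P_n$ ($n\ge 1$) is the graph with vertices $x_1,\dots,x_n$ and edges $\{x_i,x_{i+1}\}$, $1\le i\le n-1$. A linear forest is a disjoint union of finitely many path graphs. The complement $\Lambda^c$ of a graph $\Lambda$ has vertex set $V(\Lambda)$, with two distinct vertices adjacent in $\Lambda^c$ iff they are non-adjacent in $\Lambda$. The extension graph $\Gamma^e$ of a finite graph $\Gamma$ is the graph whose vertex set is the set of elements of $A(\Gamma)$ conjugate to some vertex of $\Gamma$ (i.e. elements $gvg^{-1}$, $g\in A(\Gamma)$, $v\in V(\Gamma)$), two distinct such elements being adjacent iff they commute in $A(\Gamma)$. *)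

(* Defs.v *)
From mathcomp Require Import all_boot.
Set Implicit Arguments. Unset Strict Implicit. Unset Printing Implicit Defensive.

Definition simple_graph (T : finType) (e : rel T) : Prop :=
  symmetric e /\ irreflexive e.

(* Linear forest: e is isomorphic to a disjoint union of path graphs
   P_{ns_0}, ..., P_{ns_{k-1}} (ns_i >= 1).  The vertex (i,j) with
   i < size ns, j < nth 0 ns i is the j-th vertex of the i-th path;
   (i,j) ~ (i',j') iff i = i' and |j - j'| = 1. *)
Definition path_forest_adj (a b : nat * nat) : bool :=
  (a.1 == b.1) && ((a.2.+1 == b.2) || (b.2.+1 == a.2)).

Definition linear_forest (T : finType) (e : rel T) : Prop :=
  exists (ns : seq nat) (f : T -> nat * nat),
    all (fun n => 0 < n) ns /\
    injective f /\
    (forall x, (f x).1 < size ns /\ (f x).2 < nth 0 ns (f x).1) /\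
    (forall i j, i < size ns -> j < nth 0 ns i -> exists x, f x = (i, j)) /\
    (forall x y, e x y = path_forest_adj (f x) (f y)).

Definition compl_rel (T : finType) (e : rel T) : rel T :=
  fun x y => (x != y) && ~~ e x y.

(* Words in the generators of A(Gamma) and their inverses:
   (v, false) = v, (v, true) = v^{-1}. *)
Definition word (T : finType) := seq (T * bool).

Definition winv (T : finType) (w : word T) : word T :=
  rev (map (fun l => (l.1, ~~ l.2)) w).

Inductive raag_eq (T : finType) (e : rel T) : word T -> word T -> Prop :=
| raag_refl w : raag_eq e w w
| raag_sym w1 w2 : raag_eq e w1 w2 -> raag_eq e w2 w1
| raag_trans w1 w2 w3 : raag_eq e w1 w2 -> raag_eq e w2 w3 -> raag_eq e w1 w3
| raag_cancel (s1 s2 : word T) x b :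
    raag_eq e (s1 ++ [:: (x, b); (x, ~~ b)] ++ s2) (s1 ++ s2)
| raag_comm (s1 s2 : word T) x y b c :
    e x y ->
    raag_eq e (s1 ++ [:: (x, b); (y, c)] ++ s2) (s1 ++ [:: (y, c); (x, b)] ++ s2).

(* A homomorphism A(Lambda) -> A(Gamma) is determined by the images
   phi v of the generators, subject to preserving the relations. *)
Definition hom_ext (TL TG : finType) (phi : TL -> word TG) (w : word TL)
  : word TG :=
  flatten (map (fun l => if l.2 then winv (phi l.1) else phi l.1) w).

Definition is_raag_hom (TL TG : finType) (eL : rel TL) (eG : rel TG)
  (phi : TL -> word TG) : Prop :=
  forall x y, eL x y -> raag_eq eG (phi x ++ phi y) (phi y ++ phi x).

Definition injective_raag_hom (TL TG : finType) (eL : rel TL) (eG : rel TG)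
  (phi : TL -> word TG) : Prop :=
  is_raag_hom eL eG phi /\
  forall w1 w2 : word TL,
    raag_eq eG (hom_ext phi w1) (hom_ext phi w2) -> raag_eq eL w1 w2.

Definition ext_vertex (T : finType) (e : rel T) (w : word T) : Prop :=
  exists (g : word T) (v : T), raag_eq e (g ++ [:: (v, false)] ++ winv g) w.

Definition raag_commute (T : finType) (e : rel T) (a b : word T) : Prop :=
  raag_eq e (a ++ b) (b ++ a).

(* Full embedding Lambda -> Gamma^e: injective on vertices (as elements of
   A(Gamma)), and for distinct vertices, adjacency in Lambda iff the images
   are adjacent in Gamma^e (distinct and commuting). *)
Definition full_embedding_ext (TL TG : finType) (eL : rel TL) (eG : rel TG)
  (iota : TL -> word TG) : Prop :=
  (forall x, ext_vertex eG (iota x)) /\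
  (forall x y, x != y -> ~ raag_eq eG (iota x) (iota y)) /\
  (forall x y, x != y ->
     (eL x y <-> ~ raag_eq eG (iota x) (iota y) /\ raag_commute eG (iota x) (iota y))).

(* Main.v *)
(** Reduced words of a right-angled Artin group are traces, and a trace is
    determined by its projections to pairs of non-commuting vertices; commuting
    or conjugating relations between reduced words thus become equations between
    ordinary words.  This yields the centralizer theorem in the following form:
    every element is a product of commuting pure elements (conjugates of
    cyclically reduced words whose support is connected in the non-commutation
    graph), elements commute iff their pure factors do, and two commuting pure
    elements either have a common non-trivial power or have supports that
    commute and are disjoint.  Hence, after passing to M-th powers, an embedding
    of A(Lambda) sends each generator to a product of powers of finitely many
    pure elements z_c, and induces an injective map on M-th powers into the
    right-angled Artin group A(B) on the symbols c, where the image of every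
    generator is supported on a clique.

    For a path x_0, ..., x_{n-1} in the complement of Lambda, the iterated
    commutator [x_0, ..., x_{n-1}] is non-trivial, which forces a chain
    c_0, ..., c_{n-1} of successively non-commuting symbols in the supports of
    the images; it is an induced path unless n = 3, where an iterated commutator
    of x_1 with elements of <x_0, x_2> is used instead, and the isolated
    vertices are handled by comparing ranks of free abelian groups.  So Lambda
    is a full subgraph of B.  Finally the symbols of a path of B are replaced by
    vertices of the extension graph: the generators involved in z_c form a
    connected set, and a shortest walk through these sets is an induced path
    with at least as many vertices. *)

From Stdlib Require Import Setoid Morphisms Classical FunctionalExtensionality.
Require Import Defs.
From mathcomp Require Import all_boot all_order all_algebra zify ring lra.
Set Implicit Arguments. Unset Strict Implicit. Unset Printing Implicit Defensive.
Import Order.TTheory GRing.Theory Num.Theory.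

(** * Powers of sequences *)

Section Powers.
Variable S : Type.
Implicit Types (X Y : seq S) (n : nat).

Definition wpow X n : seq S := flatten (nseq n X).

Lemma wpowS X n : wpow X n.+1 = X ++ wpow X n.
Proof. by []. Qed.

Lemma wpowD X m n : wpow X (m + n) = wpow X m ++ wpow X n.
Proof. by rewrite /wpow nseqD flatten_cat. Qed.

Lemma wpowSr X n : wpow X n.+1 = wpow X n ++ X.
Proof. by rewrite -addn1 wpowD wpowS /= cats0. Qed.

Lemma wpowM X m n : wpow X (m * n) = wpow (wpow X m) n.
Proof. by elim: n => [|n IH]; rewrite ?muln0 // mulnS wpowD IH. Qed.

Lemma wpow_nil n : wpow [::] n = [::] :> seq S.
Proof. by elim: n. Qed.

Lemma size_wpow X n : size (wpow X n) = n * size X.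
Proof. by elim: n => // n IH; rewrite wpowS size_cat IH mulSn. Qed.

Lemma count_wpow (P : pred S) X n : count P (wpow X n) = n * count P X.
Proof. by elim: n => // n IH; rewrite wpowS count_cat IH mulSn. Qed.

Lemma filter_wpow (P : pred S) X n : filter P (wpow X n) = wpow (filter P X) n.
Proof. by elim: n => // n IH; rewrite !wpowS filter_cat IH. Qed.

Lemma all_wpow (P : pred S) X n : all P X -> all P (wpow X n).
Proof. by move=> PX; elim: n => // n IH; rewrite wpowS all_cat PX. Qed.

Lemma filter_predC_nil (P : pred S) X : all (predC P) X -> filter P X = [::].
Proof. by elim: X => //= x X IH /andP [/negPf -> /IH]. Qed.

Lemma sorted_wpow (r : rel S) X n : sorted r (X ++ X) -> sorted r (wpow X n).
Proof.
case: X => [|y X]; first by rewrite wpow_nil.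
rewrite /= cat_path /= => /and3P [H1 H2 _].
case: n => //= n; rewrite cat_path H1 /=.
by elim: n => //= n IH; rewrite H2 cat_path H1.
Qed.

End Powers.

(** * Commuting words in the free monoid *)

Section CommutingSequences.
Variable S : eqType.
Implicit Types X Y : seq S.

Lemma wpow_comm X Y n : X ++ Y = Y ++ X -> X ++ wpow Y n = wpow Y n ++ X.
Proof.
move=> H; elim: n => [|n IH]; first by rewrite cats0.
by rewrite wpowS catA H -!catA IH.
Qed.

Lemma wpow_comm2 X Y m n : X ++ Y = Y ++ X -> wpow X m ++ wpow Y n = wpow Y n ++ wpow X m.
Proof. by move=> H; apply: wpow_comm; apply/esym/wpow_comm. Qed.

Lemma comm_size_eq X Y : X ++ Y = Y ++ X -> size X = size Y -> X = Y.
Proof. by move=> H E; move/eqP: H; rewrite eqseq_cat // => /andP [/eqP]. Qed.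

Lemma comm_take X Y : X ++ Y = Y ++ X -> size X <= size Y -> X = take (size X) Y.
Proof. by move=> H L; move: (congr1 (take (size X)) H); rewrite take_size_cat // takel_cat. Qed.

(* Both XY and YX commute with A = X^n, so they are prefixes of the same length
   of a power of A. *)
Lemma wpow_comm_inv X Y n : 0 < n -> wpow X n ++ Y = Y ++ wpow X n -> X ++ Y = Y ++ X.
Proof.
move=> n0; case: (posnP (size X)) => [/size0nil -> | X0 H]; first by rewrite cats0.
set A := wpow X n in H; have A0 : 0 < size A by rewrite size_wpow muln_gt0 n0.
have HX : X ++ A = A ++ X by apply: wpow_comm.
pose k := size (X ++ Y); pose B := wpow A k.
have Lk : k <= size B by rewrite size_wpow leq_pmulr.
have C1 : (X ++ Y) ++ B = B ++ (X ++ Y).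
  by apply: wpow_comm; rewrite -catA -H !catA HX.
have C2 : (Y ++ X) ++ B = B ++ (Y ++ X).
  by apply: wpow_comm; rewrite -catA HX !catA H.
have Ek : size (Y ++ X) = k by rewrite size_cat addnC -size_cat.
by rewrite (comm_take C1 Lk) (@comm_take (Y ++ X) B) ?Ek.
Qed.

(** Commuting words satisfy [X^|Y| = Y^|X|], both sides having the same length, so all letter counts
    of [X] and [Y] are proportional. *)
Lemma comm_count_ratio (P Q : pred S) X Y : X ++ Y = Y ++ X -> 0 < size X ->
  count P Y * count Q X = count Q Y * count P X.
Proof.
move=> H X0; have E : wpow X (size Y) = wpow Y (size X).
  by apply: comm_size_eq; [apply: wpow_comm2 | rewrite !size_wpow mulnC].
have := congr1 (count P) E; have := congr1 (count Q) E; rewrite !count_wpow.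
move=> EQ EP; apply/eqP; rewrite -(eqn_pmul2l X0) !mulnA -EP -EQ.
by rewrite -!mulnA (mulnC (count P X)).
Qed.

End CommutingSequences.

(** * Words *)

#[global] Hint Resolve raag_refl : core.

Section Words.
Variable T : finType.
Implicit Types (w s : word T) (x y z : T * bool) (n : nat).

Definition linv x : T * bool := (x.1, ~~ x.2).

Lemma linvK : involutive linv.
Proof. by case=> u b; rewrite /linv /= negbK. Qed.

Lemma winv_cat w s : winv (w ++ s) = winv s ++ winv w.
Proof. by rewrite /winv map_cat rev_cat. Qed.

Lemma winv_cons x w : winv (x :: w) = rcons (winv w) (linv x).
Proof. by rewrite /winv /= rev_cons. Qed.

Lemma winv_rcons w x : winv (rcons w x) = linv x :: winv w.
Proof. by rewrite /winv map_rcons rev_rcons. Qed.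

Lemma winvK : involutive (@winv T).
Proof.
elim=> // x w IH; rewrite winv_cons winv_rcons IH; congr cons.
exact: linvK.
Qed.

Lemma size_winv w : size (winv w) = size w.
Proof. by rewrite /winv size_rev size_map. Qed.

Lemma winv_letters (P : pred T) w :
  all (fun y => P y.1) (winv w) = all (fun y => P y.1) w.
Proof. by rewrite /winv all_rev all_map; apply: eq_all. Qed.

Lemma filter_winv (P : pred T) w :
  filter (fun y => P y.1) (winv w) = winv (filter (fun y => P y.1) w).
Proof. by rewrite /winv filter_rev filter_map. Qed.

Lemma winv_wpow w n : winv (wpow w n) = wpow (winv w) n.
Proof. by elim: n => // n IH; rewrite wpowS wpowSr winv_cat IH. Qed.

Definition proj (u v : T) w := [seq y <- w | (y.1 == u) || (y.1 == v)].

Lemma proj_cat u v w s : proj u v (w ++ s) = proj u v w ++ proj u v s.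
Proof. exact: filter_cat. Qed.

Definition supp w : seq T := [seq y.1 | y <- w].

Lemma supp_cat w s : supp (w ++ s) = supp w ++ supp s.
Proof. exact: map_cat. Qed.

Lemma supp_winv w : supp (winv w) =i supp w.
Proof. by move=> u; rewrite /supp /winv map_rev mem_rev -map_comp. Qed.

Lemma supp_wpow1 x n u : u \in supp (wpow [:: x] n) -> u = x.1.
Proof.
case/mapP=> y yn ->; have /allP /(_ _ yn) /eqP // : all (fun z => z.1 == x.1) (wpow [:: x] n).
by apply: all_wpow; rewrite /= eqxx.
Qed.

End Words.

(** * Calculus in the group: congruences, commutation, conjugation *)

Section Raag.
Variables (T : finType) (e : rel T).
Hypotheses (e_sym : symmetric e) (e_irr : irreflexive e).
Implicit Types (w s : word T) (x y z : T * bool).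
Local Notation "a ≡ b" := (raag_eq e a b) (at level 70).

Lemma raag_eq_ctx s s' w w' : w ≡ w' -> s ++ w ++ s' ≡ s ++ w' ++ s'.
Proof.
elim=> [?|? ? _ ?|? ? ? _ H1 _ H2|s1 s2 x b|s1 s2 x y b c exy].
- exact: raag_refl.
- exact: raag_sym.
- exact: raag_trans H1 H2.
- have := @raag_cancel T e (s ++ s1) (s2 ++ s') x b.
  by rewrite -!catA.
- have := @raag_comm T e (s ++ s1) (s2 ++ s') x y b c exy.
  by rewrite -!catA.
Qed.

#[export] Instance raag_eq_equiv : Equivalence (raag_eq e).
Proof.
split; first exact: raag_refl.
- by move=> a b; exact: raag_sym.
- by move=> a b c; exact: raag_trans.
Qed.

#[export] Instance cat_raag_eq : Proper (raag_eq e ==> raag_eq e ==> raag_eq e) cat.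
Proof.
move=> a a' Ha b b' Hb; transitivity (a' ++ b).
- by have := raag_eq_ctx [::] b Ha.
- by have := raag_eq_ctx a' [::] Hb; rewrite !cats0.
Qed.

#[export] Instance cons_raag_eq x : Proper (raag_eq e ==> raag_eq e) (cons x).
Proof. by move=> a b H; apply: (@cat_raag_eq [:: x] [:: x]). Qed.

#[export] Instance winv_raag_eq : Proper (raag_eq e ==> raag_eq e) (@winv T).
Proof.
move=> w w'; elim=> [?|? ? _ ?|? ? ? _ H1 _ H2|s1 s2 x b|s1 s2 x y b c exy].
- exact: raag_refl.
- exact: raag_sym.
- exact: raag_trans H1 H2.
- rewrite !winv_cat -catA /winv /= negbK.
  exact: (raag_cancel e _ _ x b).
- rewrite !winv_cat -!catA /winv /=.
  by apply: raag_comm; rewrite e_sym.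
Qed.

Lemma catwV w : w ++ winv w ≡ [::].
Proof.
elim: w => [|[u b] w IH]; first by [].
rewrite winv_cons -cats1 /=.
have := raag_eq_ctx [:: (u, b)] [:: linv (u, b)] IH; rewrite /= -catA => ->.
exact: (raag_cancel e [::] [::] u b).
Qed.

Lemma catVw w : winv w ++ w ≡ [::].
Proof. by have := catwV (winv w); rewrite winvK. Qed.

Lemma catVKw w s : winv w ++ w ++ s ≡ s.
Proof. by rewrite catA catVw. Qed.

Lemma catKVw w s : w ++ winv w ++ s ≡ s.
Proof. by rewrite catA catwV. Qed.

Lemma cat_cancel_l w s s' : w ++ s ≡ w ++ s' -> s ≡ s'.
Proof. by move=> H; rewrite -(catVKw w s) H catVKw. Qed.

Lemma cat_cancel_r w s s' : s ++ w ≡ s' ++ w -> s ≡ s'.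
Proof.
by move=> H; rewrite -[s]cats0 -(catwV w) catA H -catA catwV cats0.
Qed.

#[export] Instance wpow_raag_eq : Proper (raag_eq e ==> eq ==> raag_eq e) (@wpow (T * bool)).
Proof. by move=> a b H n _ <-; elim: n => // n IH; rewrite !wpowS IH H. Qed.

Definition comm w s := raag_commute e w s.

#[export] Instance comm_raag_eq : Proper (raag_eq e ==> raag_eq e ==> iff) comm.
Proof.
move=> a a' Ha b b' Hb; rewrite /comm /raag_commute.
by split=> H; [rewrite -Ha -Hb | rewrite Ha Hb].
Qed.

Lemma comm_refl w : comm w w. Proof. exact: raag_refl. Qed.

Lemma comm_sym w s : comm w s -> comm s w.
Proof. exact: raag_sym. Qed.

Lemma comm_nil w : comm w [::].
Proof. by rewrite /comm /raag_commute cats0. Qed.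

Lemma comm_cat a b c : comm a b -> comm a c -> comm a (b ++ c).
Proof.
rewrite /comm /raag_commute => H1 H2.
by rewrite catA H1 -catA H2 -catA.
Qed.

Lemma comm_winv a b : comm a b -> comm a (winv b).
Proof.
rewrite /comm /raag_commute => H.
apply: (@cat_cancel_l b); rewrite catKVw catA -H -catA catwV cats0.
reflexivity.
Qed.

Lemma comm_wpow a b n : comm a b -> comm a (wpow b n).
Proof.
move=> H; elim: n => [|n IH]; first exact: comm_nil.
by rewrite wpowS; apply: comm_cat.
Qed.

Lemma comm_flatten a bs : (forall b, b \in bs -> comm a b) -> comm a (flatten bs).
Proof.
elim: bs => [|b bs IH] H; first exact: comm_nil.
apply: comm_cat; first by apply: H; rewrite inE eqxx.
by apply: IH => c cbs; apply: H; rewrite inE cbs orbT.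
Qed.

Definition cnj g w := g ++ w ++ winv g.

#[export] Instance conj_raag_eq : Proper (raag_eq e ==> raag_eq e ==> raag_eq e) cnj.
Proof. by move=> a a' Ha b b' Hb; rewrite /cnj Ha Hb. Qed.

Lemma conjM g h w : cnj (g ++ h) w = cnj g (cnj h w).
Proof. by rewrite /cnj winv_cat !catA. Qed.

Lemma conj_cat g w s : cnj g (w ++ s) ≡ cnj g w ++ cnj g s.
Proof. by rewrite /cnj -!catA catVKw. Qed.

Lemma conjK g w : cnj (winv g) (cnj g w) ≡ w.
Proof. by rewrite /cnj winvK -!catA catVKw catVw cats0. Qed.

Lemma conjVK g w : cnj g (cnj (winv g) w) ≡ w.
Proof. by rewrite -{1}[g]winvK conjK. Qed.

Lemma conj_nil g : cnj g [::] ≡ [::].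
Proof. exact: catwV. Qed.

Lemma conj_winv g w : cnj g (winv w) = winv (cnj g w).
Proof. by rewrite /cnj !winv_cat winvK catA. Qed.

Lemma conj_wpow g w n : cnj g (wpow w n) ≡ wpow (cnj g w) n.
Proof.
elim: n => [|n IH]; first exact: conj_nil.
by rewrite !wpowS conj_cat IH.
Qed.

Lemma conj_flatten g bs :
  cnj g (flatten bs) ≡ flatten (map (cnj g) bs).
Proof.
elim: bs => [|b bs IH]; first exact: conj_nil.
by rewrite /= conj_cat IH.
Qed.

Lemma comm_conj g a b : comm (cnj g a) (cnj g b) <-> comm a b.
Proof.
rewrite /comm /raag_commute -!conj_cat; split=> H; last by rewrite H.
by rewrite -(conjK g (a ++ b)) H conjK.
Qed.

Lemma comm_letters w s :
  (forall y z, y \in w -> z \in s -> e y.1 z.1 \/ y.1 = z.1) -> comm w s.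
Proof.
have L1 y z : e y.1 z.1 \/ y.1 = z.1 -> comm [:: y] [:: z].
  case: y z => [u b] [v c] /= [euv|->].
    exact: (raag_comm [::] [::] b c euv).
  case: (b =P c) => [->|bc]; first exact: comm_refl.
  suff -> : [:: (v, c)] = winv [:: (v, b)] by apply/comm_winv/comm_refl.
  by rewrite /winv /=; case: b c bc => [] [].
have L2 y s' : (forall z, z \in s' -> e y.1 z.1 \/ y.1 = z.1) -> comm [:: y] s'.
  elim: s' => [|z s' IH] H; first exact: comm_nil.
  rewrite -(cat1s z); apply: comm_cat; first by apply/L1/H; rewrite inE eqxx.
  by apply: IH => t ts; apply: H; rewrite inE ts orbT.
elim: w => [|y w IH] H; first by apply: comm_sym; apply: comm_nil.
rewrite -(cat1s y); apply: comm_sym; apply: comm_cat; apply: comm_sym.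
  by apply: L2 => z zs; apply: H => //; rewrite inE eqxx.
by apply: IH => t z tw zs; apply: H => //; rewrite inE tw orbT.
Qed.

(** * Traces: words up to commutation, without cancellation *)

(* Trace equivalence, by projections; the case u = v is included as e is irreflexive. *)
Definition teq w w' := forall u v, ~~ e u v -> proj u v w = proj u v w'.

Lemma teq_refl w : teq w w. Proof. by []. Qed.
Lemma teq_sym w s : teq w s -> teq s w.
Proof. by move=> H u v uv; rewrite H. Qed.
Lemma teq_trans w1 w2 w3 : teq w1 w2 -> teq w2 w3 -> teq w1 w3.
Proof. by move=> H1 H2 u v uv; rewrite H1 ?H2. Qed.
Lemma teq_cat w1 w2 s1 s2 : teq w1 w2 -> teq s1 s2 -> teq (w1 ++ s1) (w2 ++ s2).
Proof. by move=> H1 H2 u v uv; rewrite !proj_cat H1 ?H2. Qed.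

Lemma teq_swap w s :
  (forall y z, y \in w -> z \in s -> e y.1 z.1) -> teq (w ++ s) (s ++ w).
Proof.
move=> H u v uv; rewrite !proj_cat.
case Ew: (proj u v w) => [|y w']; first by rewrite cats0.
case Es: (proj u v s) => [|z s']; first by rewrite cats0.
have: y \in proj u v w by rewrite Ew inE eqxx.
have: z \in proj u v s by rewrite Es inE eqxx.
rewrite !mem_filter => /andP [Hz zs] /andP [Hy yw].
have := H _ _ yw zs.
by case/orP: Hy => /eqP ->; case/orP: Hz => /eqP ->;
   rewrite ?e_irr // ?(negPf uv) // e_sym (negPf uv).
Qed.

Lemma teq_cons_inv x w s : teq (x :: w) (x :: s) -> teq w s.
Proof. by move=> H u v /H; rewrite /proj /=; case: ifP => // _ []. Qed.

(** The letters that a letter over [u] cannot pass. Since [e] is irreflexive, the letters over [u]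
    itself are among them. *)
Definition star u w := [seq y <- w | ~~ e u y.1].

Lemma proj_star u v w : ~~ e u v -> proj u v w = proj u v (star u w).
Proof.
move=> uv; rewrite /proj /star -filter_predI; apply: eq_filter => y /=.
by case: eqP => [->|_] /=; [rewrite e_irr|case: eqP => [->|]].
Qed.

(* x can be moved to the front of w by commutations. *)
Definition acc x w := ohead (star x.1 w) == Some x.

Lemma accP x w :
  reflect (exists s1 s2, w = s1 ++ x :: s2 /\ all (fun y => e x.1 y.1) s1) (acc x w).
Proof.
apply: (iffP eqP).
- elim: w => [|y w IH] //=; case: ifP => /= [_ [->]|/negbFE exy /IH [s1 [s2 [-> H]]]].
    by exists [::], w.
  by exists (y :: s1), s2; rewrite /= exy.
- move=> [s1 [s2 [-> H]]]; rewrite /star filter_cat /= e_irr /=.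
  suff -> : [seq y <- s1 | ~~ e x.1 y.1] = [::] by [].
  apply: filter_predC_nil.
  by apply: sub_all H => y /= ->.
Qed.

(** If the first letter of [s] that blocks [x] were some [y] other than [x], the projections of [w]
    and [s] to the pair of their vertices would begin with different letters. *)
Lemma teq_acc x w s : teq w s -> acc x w -> acc x s.
Proof.
move=> H; rewrite /acc; case Ew: (star x.1 w) => [|y0 w'] //= /eqP [yx].
rewrite {}yx in Ew; case Es: (star x.1 s) => [|y s'].
  have := H x.1 x.1; rewrite e_irr => /(_ isT).
  by rewrite (@proj_star _ _ w) ?(@proj_star _ _ s) ?e_irr // Ew Es /= /proj /= eqxx.
have: y \in star x.1 s by rewrite Es inE eqxx.
rewrite mem_filter => /andP [xy _].
have := H _ _ xy; rewrite (@proj_star _ _ w) ?(@proj_star _ _ s) // Ew Es /= /proj /= !eqxx orbT /=.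
by case=> ->.
Qed.

Lemma acc_split x w : acc x w ->
  exists s1 s2, [/\ w = s1 ++ x :: s2, rem x w = s1 ++ s2,
                 all (fun y => e x.1 y.1) s1 & teq w (x :: s1 ++ s2)].
Proof.
case/accP=> s1 [s2 [-> H]]; exists s1, s2; split=> //.
- elim: s1 H => [|y s1 IH] /=; first by rewrite eqxx.
  case/andP=> exy /IH ->; case: eqP => // yx.
  by rewrite yx e_irr in exy.
- rewrite -cat_cons -cat_rcons; apply: teq_cat => //; rewrite -cats1.
  rewrite -[x :: s1]cat1s.
  apply: teq_swap => y z ys; rewrite inE => /eqP ->.
  by rewrite e_sym; apply: (allP H).
Qed.

Lemma teq_rem x w : acc x w -> teq w (x :: rem x w).
Proof. by case/acc_split=> s1 [s2 [_ -> _]]. Qed.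

Lemma teq_nil w : teq [::] w -> w = [::].
Proof.
case: w => // y w /(_ y.1 y.1); rewrite e_irr => /(_ isT).
by rewrite /proj /= eqxx.
Qed.

Lemma teq_cons x w s : teq (x :: w) s -> acc x s /\ teq w (rem x s).
Proof.
move=> H; have A : acc x s.
  by apply: (teq_acc H); rewrite /acc /= e_irr.
split=> //; apply: (@teq_cons_inv x); apply: teq_trans H _; exact: teq_rem.
Qed.

(** Induction on [w]: its first letter is accessible in [s], so it can be commuted to the front of
    [s] and split off on both sides. *)
Lemma teq_raag w s : teq w s -> w ≡ s.
Proof.
elim: w s => [|x w IH] s H; first by rewrite (teq_nil H).
case: (teq_cons H) => /acc_split [s1 [s2 [Es -> He _]]] /IH ->.
rewrite Es -cat_cons -cat_rcons -cats1 -(cat1s x s1).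
apply: cat_raag_eq; last reflexivity.
apply: comm_letters => y z; rewrite inE => /eqP -> /(allP He) ?; by left.
Qed.

Lemma teq_size w s : teq w s -> size w = size s.
Proof.
elim: w s => [|x w IH] s H; first by rewrite (teq_nil H).
case: (teq_cons H) => A /IH /= ->.
have [s1 [s2 [-> -> _ _]]] := acc_split A.
by rewrite !size_cat /= addnS.
Qed.

(** * Reduced words *)

Definition nocancel u : rel (T * bool) :=
  fun y z => ~~ [&& y.1 == u, z.1 == u & y.2 != z.2].

(* Consecutive letters u and u^-1 of star u w are exactly the letters of w that
   can be brought together and cancelled. *)
Definition reduced w := [forall u, sorted (nocancel u) (star u w)].

Lemma sorted_nocancel_cat u w s : all (fun y => y.1 != u) w ->
  sorted (nocancel u) (w ++ s) = sorted (nocancel u) s.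
Proof.
elim: w => // y w IH /= /andP [yu /IH <-].
case: (w ++ s) => //= z r.
by rewrite /nocancel (negPf yu).
Qed.

(** A new first letter [x] can create a cancelling pair only in the star of its own vertex, and
    there the pair consists of [x] and an accessible inverse. *)
Lemma reduced_cons x w : reduced (x :: w) = reduced w && ~~ acc (linv x) w.
Proof.
have S u : ~~ e u x.1 -> u != x.1 -> star u (x :: w) = x :: star u w.
  by move=> H _; rewrite /star /= H.
have Ex : sorted (nocancel x.1) (star x.1 (x :: w)) =
    sorted (nocancel x.1) (star x.1 w) && ~~ acc (linv x) w.
  rewrite /star /= e_irr /= /acc /= -/(star x.1 w).
  case: (star x.1 w) => [|y r] //=; rewrite andbC; congr (_ && _).
  rewrite /nocancel eqxx /= /linv; case: x y {S} => [u b] [v c] /=.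
  have -> : (Some (v, c) == Some (u, ~~ b)) = ((v, c) == (u, ~~ b)) by [].
  by rewrite xpair_eqE; case: b c => [] [].
have Eu u : u != x.1 -> sorted (nocancel u) (star u (x :: w)) =
    sorted (nocancel u) (star u w).
  move=> ux; rewrite /star /=; case: ifP => // _.
  by apply: (@sorted_nocancel_cat u [:: x]); rewrite /= eq_sym ux.
apply/forallP/idP.
- move=> H; have := H x.1; rewrite Ex => /andP [H1 ->]; rewrite andbT.
  apply/forallP => u; case: (eqVneq u x.1) => [->//|ux]; by rewrite -Eu.
- case/andP=> /forallP H A u; case: (eqVneq u x.1) => [->|ux].
    by rewrite Ex H.
  by rewrite Eu.
Qed.

Lemma reduced_move x s1 s2 : all (fun y => e x.1 y.1) s1 ->
  reduced (s1 ++ x :: s2) = reduced (x :: s1 ++ s2).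
Proof.
move=> H; rewrite /reduced; apply: eq_forallb => u.
rewrite /star /= !filter_cat /=.
case: (eqVneq u x.1) => [->|ux].
  suff -> : [seq y <- s1 | ~~ e x.1 y.1] = [::] by [].
  apply: filter_predC_nil.
  by apply: sub_all H => y /= ->.
case: ifP => // eux.
have N : all (fun y : T * bool => y.1 != u) [seq y <- s1 | ~~ e u y.1].
  apply/allP => y; rewrite mem_filter => /andP [_ /(allP H)].
  by apply: contraTneq => ->; rewrite e_sym.
rewrite (sorted_nocancel_cat _ N) -!cat_cons -[x :: filter _ _]cat1s.
by rewrite -[x :: filter _ s1]cat1s !sorted_nocancel_cat //= ?N eq_sym ux.
Qed.

Lemma teq_reduced w s : teq w s -> reduced w = reduced s.
Proof.
elim: w s => [|x w IH] s H; first by rewrite (teq_nil H).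
case: (teq_cons H) => A B; have E := IH _ B.
have [s1 [s2 [Es Er He _]]] := acc_split A.
rewrite Es reduced_move // !reduced_cons E Er; congr (_ && ~~ _).
by rewrite Er in B; apply/idP/idP; apply: teq_acc => //; apply: teq_sym.
Qed.

(** Left multiplication by a letter on reduced words. As in van der Waerden's proof of normal forms,
    these maps satisfy the relations of the group up to [teq]. *)
Definition push x w := if acc (linv x) w then rem (linv x) w else x :: w.

Lemma push_reduced x w : reduced w -> reduced (push x w).
Proof.
rewrite /push => R; case: ifP => A; last by rewrite reduced_cons R A.
by have := teq_reduced (teq_rem A); rewrite R reduced_cons => /esym /andP [].
Qed.

Lemma teq_push x w s : teq w s -> teq (push x w) (push x s).
Proof.
move=> H; have E : acc (linv x) w = acc (linv x) s.
  by apply/idP/idP; apply: teq_acc => //; apply: teq_sym.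
rewrite /push E; case: ifP => A; last exact: (@teq_cat [:: x] [:: x]).
apply: (@teq_cons_inv (linv x)); apply: teq_trans (teq_rem A).
by apply: teq_trans H; apply/teq_sym/teq_rem; rewrite E.
Qed.

Lemma push_linv x w : reduced w -> teq (push x (push (linv x) w)) w.
Proof.
move=> R; rewrite /push linvK; case A: (acc x w).
  have TR := teq_rem A; have := teq_reduced TR.
  by rewrite R reduced_cons => /esym /andP [_ /negPf ->]; exact: teq_sym.
by rewrite /acc /= e_irr /= eqxx /= eqxx.
Qed.

Lemma acc_push x y w : e x.1 y.1 -> acc x (push y w) = acc x w.
Proof.
move=> exy; rewrite /push /acc; case: ifP => A; last by rewrite /= exy.
have [s1 [s2 [-> -> _ _]]] := acc_split A.
by rewrite /star !filter_cat /= exy.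
Qed.

Lemma push_comm x y w : e x.1 y.1 -> teq (push x (push y w)) (push y (push x w)).
Proof.
move=> exy; have eyx : e y.1 x.1 by rewrite e_sym.
have xy : x.1 != y.1 by apply: contraTneq exy => ->; rewrite e_irr.
have Hy : acc (linv y) (push x w) = acc (linv y) w by rewrite acc_push.
have Hx : acc (linv x) (push y w) = acc (linv x) w by rewrite acc_push.
have sw s : teq ([:: x; y] ++ s) ([:: y; x] ++ s).
  apply: teq_cat => //; apply: (@teq_swap [:: x] [:: y]) => ? ?.
  by rewrite !inE => /eqP -> /eqP ->.
have pE z r : push z r = if acc (linv z) r then rem (linv z) r else z :: r by [].
rewrite (pE x) Hx (pE y (push x w)) Hy !pE.
have nx : y == linv x = false by apply: contraNF xy => /eqP -> /=.
have ny : x == linv y = false by apply: contraNF xy => /eqP -> /=.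
case Ax: (acc (linv x) w); case Ay: (acc (linv y) w) => //=; rewrite ?nx ?ny //; last exact: sw.
move: Hx Hy; rewrite !pE Ax Ay => Hx Hy.
apply: (@teq_cons_inv (linv y)); apply: (@teq_cons_inv (linv x)).
apply: (@teq_trans _ w); last first.
  by apply: teq_trans (teq_rem Ax) _; apply: (@teq_cat [:: _] [:: _]) => //; exact: teq_rem.
apply: teq_trans (teq_sym (teq_rem Ay)).
apply: (@teq_trans _ (linv y :: linv x :: rem (linv x) (rem (linv y) w))); last first.
  by apply: (@teq_cat [:: _] [:: _]) => //; exact/teq_sym/teq_rem.
apply: (@teq_cat [:: _; _] [:: _; _]) => //.
apply: (@teq_swap [:: _] [:: _]) => ? ?.
by rewrite !inE => /eqP -> /eqP ->.
Qed.

Definition red w := foldr push [::] w.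

Lemma foldr_push_reduced w s : reduced s -> reduced (foldr push s w).
Proof. by move=> R; elim: w => //= x w IH; apply: push_reduced. Qed.

Lemma reduced_nil : reduced [::].
Proof. by apply/forallP. Qed.

Lemma red_reduced w : reduced (red w).
Proof. exact/foldr_push_reduced/reduced_nil. Qed.

Lemma teq_foldr_push w s s' : teq s s' -> teq (foldr push s w) (foldr push s' w).
Proof. by move=> H; elim: w => //= x w IH; apply: teq_push. Qed.

(** Invariance of the normal form: the two kinds of defining relations are handled by [push_linv]
    and [push_comm]. *)
Lemma raag_eq_red w s : w ≡ s -> teq (red w) (red s).
Proof.
elim=> [?|? ? _ ?|? ? ? _ H1 _ H2|s1 s2 x b|s1 s2 x y b c exy].
- exact: teq_refl.
- exact: teq_sym.
- exact: teq_trans H1 H2.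
- rewrite /red !foldr_cat; apply: teq_foldr_push => /=.
  exact/(@push_linv (x, b))/red_reduced.
- rewrite /red !foldr_cat; apply: teq_foldr_push => /=.
  exact: push_comm.
Qed.

Lemma push_raag x w : push x w ≡ x :: w.
Proof.
rewrite /push; case: ifP => // /teq_rem /teq_raag H.
rewrite {2}H; symmetry; case: x {H} => u b.
exact: (raag_cancel e [::] _ u b).
Qed.

Lemma red_raag w : red w ≡ w.
Proof. by elim: w => //= x w IH; rewrite push_raag IH. Qed.

Lemma reduced_red w : reduced w -> red w = w.
Proof.
elim: w => //= x w IH; rewrite reduced_cons => /andP [/IH -> /negPf A].
by rewrite /push A.
Qed.

Lemma reduced_teq w s : reduced w -> reduced s -> w ≡ s -> teq w s.
Proof. by move=> /reduced_red {2}<- /reduced_red {2}<- /raag_eq_red. Qed.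

Lemma size_push x w : size (push x w) <= (size w).+1.
Proof.
rewrite /push; case: ifP => // /acc_split [s1 [s2 [-> -> _ _]]].
by rewrite !size_cat /=; apply: leqW; rewrite leq_add2l.
Qed.

Lemma size_foldr_push w s : size (foldr push s w) <= size w + size s.
Proof. by elim: w => //= x w; rewrite -ltnS; apply: leq_trans; apply: size_push. Qed.

Lemma size_red w : size (red w) <= size w.
Proof. by rewrite -[size w]addn0; apply: size_foldr_push. Qed.

Lemma size_reduced w s : reduced w -> w ≡ s -> size w <= size s.
Proof.
move=> R H; apply: leq_trans (size_red s).
by rewrite -(teq_size (raag_eq_red H)) reduced_red.
Qed.

(** A single cancellation brings the length below the bound of [size_foldr_push], so attaining full
    length means that nothing cancels. *)
Lemma foldr_push_full w s :
  size w + size s <= size (foldr push s w) -> foldr push s w = w ++ s.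
Proof.
elim: w => //= x w IH.
rewrite {1}/push; case: ifP => [/acc_split [s1 [s2 [E -> _ _]]]|A H].
  have := size_foldr_push w s; rewrite E !size_cat /= addnS => H1 H2.
  by move: (leq_ltn_trans H2 H1); rewrite addSn ltnNge leqnSn.
by rewrite /push A IH.
Qed.

Lemma reduced_full w : size w <= size (red w) -> reduced w.
Proof.
rewrite -{1}[size w]addn0 => /(@foldr_push_full w [::]).
by rewrite cats0 => <-; apply: red_reduced.
Qed.

Lemma red_letters (P : pred (T * bool)) w : all P w -> all P (red w).
Proof.
elim: w => //= x w IH /andP [Px /IH H]; rewrite /push; case: ifP => A.
  by have [s1 [s2 [E -> _ _]]] := acc_split A; rewrite E !all_cat /= in H *; case/and3P: H => -> _ ->.
by rewrite /= Px.
Qed.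

Definition raag_eqb w s := red (w ++ winv s) == [::].

Lemma raag_eqP w s : reflect (w ≡ s) (raag_eqb w s).
Proof.
apply: (iffP eqP) => [H|H].
  apply: (@cat_cancel_r (winv s)); rewrite catwV -(red_raag (w ++ _)) H.
  exact: raag_refl.
apply: teq_nil; apply: (@raag_eq_red [::]); symmetry.
by rewrite H catwV.
Qed.

(** * Cyclically reduced words *)

Definition cyc w := reduced (w ++ w).

Lemma cyc_wpow_reduced w n : cyc w -> reduced (wpow w n).
Proof.
move/forallP=> H; apply/forallP => u; rewrite /star filter_wpow.
by apply: sorted_wpow; have := H u; rewrite /star filter_cat.
Qed.

Lemma cyc_wpow w n : cyc w -> cyc (wpow w n).
Proof. by move=> C; rewrite /cyc -wpowD; apply: cyc_wpow_reduced. Qed.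

Lemma star_last u w p z : star u w = rcons p z ->
  exists s1 s2, w = s1 ++ z :: s2 /\ all (fun y => e u y.1) s2.
Proof.
elim/last_ind: w p => [|w y IH] p; first by case: p.
rewrite /star filter_rcons; case: ifP => [_ /rcons_inj [_ ->]|/negbFE euy /IH].
  by exists w, [::]; rewrite cats1.
case=> s1 [s2 [-> H]]; exists s1, (rcons s2 y).
by rewrite rcons_cat all_rcons /= euy.
Qed.

(** As long as [red w] is not cyclically reduced, some star begins with a letter and ends with its
    inverse; stripping both shortens the word. The clause on [P] keeps conjugator and core on the
    letters of [w]. *)
Lemma cyc_conj w : exists h t, [/\ cyc t, w ≡ cnj h t &
  forall P : pred T, all (fun y => P y.1) w ->
    all (fun y => P y.1) h && all (fun y => P y.1) t].
Proof.
have [n] := ubnP (size w); elim: n w => // n IH w; rewrite ltnS => Hn.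
case: (boolP (cyc (red w))) => [C|].
  exists [::], (red w); split=> //; first by rewrite /cnj /= cats0 red_raag.
  by move=> P /red_letters ->.
rewrite negb_forall => /existsP [u].
(* The star has no cancelling pair by itself, so the failure sits at the junction of its two copies:
   last and first letter are inverse letters over [u]. *)
have := forallP (red_reduced w) u; rewrite /star filter_cat -/(star u _).
case E: (star u (red w)) => [|y r] // H.
rewrite /= cat_path; rewrite /= in H; rewrite H /= H andbT /nocancel negbK.
case/and3P=> /eqP lu /eqP yu lb.
have A : acc y (red w) by rewrite /acc yu E.
case/lastP: r E H lu lb => [|r z]; first by rewrite eqxx.
rewrite last_rcons => E H lu lb.
have zE : z = linv y.
  by case: z y lu lb yu {E H A} => [? []] [? []] //= -> _ ->.
have [s1 [s2 [Ew _ H1 Tw]]] := acc_split A.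
have E2 : star u s2 = rcons r z.
  move: E; rewrite Ew /star filter_cat /= yu e_irr /=.
  suff -> : [seq x <- s1 | ~~ e u x.1] = [::] by move=> [].
  apply: filter_predC_nil.
  by apply: sub_all H1 => x /=; rewrite yu => ->.
have [s3 [s4 [Es2 H4]]] := star_last E2.
(* [y] moves to the front past [s1] and [z] to the end past [s4], since neither segment contains a
   blocking letter. *)
have Hw : w ≡ cnj [:: y] (s1 ++ s3 ++ s4).
  rewrite -(red_raag w) (teq_raag Tw) Es2 /cnj /= /winv /= -/(linv y) -zE.
  rewrite -!catA; apply: cons_raag_eq; do 2!apply: cat_raag_eq => //.
  rewrite -(cat1s z); apply: comm_letters => a b; rewrite inE => /eqP -> /(allP H4).
  by rewrite lu; left.
have [|h [t [C Ht HP]]] := IH (s1 ++ s3 ++ s4).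
  apply: leq_trans Hn; apply: leq_trans (size_red w).
  by rewrite Ew Es2 !size_cat /= !size_cat /=; lia.
exists (y :: h), t; split=> //.
  by rewrite Hw Ht -conjM.
move=> P /red_letters; rewrite Ew Es2 all_cat /= all_cat /=.
case/and4P => P1 Py P3 /andP [_ P4].
by rewrite Py; apply: HP; rewrite !all_cat P1 P3.
Qed.

(** From [t^n = g t'^n g^-1] follows [n |t| <= n |t'| + 2 |g|], which fails for [n = 2 |g| + 1] if
    [t] is longer than [t']. *)
Lemma cyc_size_le g t t' : cyc t -> cyc t' -> t ++ g ≡ g ++ t' -> size t <= size t'.
Proof.
move=> C C' H; rewrite leqNgt; apply/negP => L.
have HE n : wpow t n ++ g ≡ g ++ wpow t' n.
  elim: n => [|n IH]; first by rewrite cats0.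
  by rewrite !wpowS -catA IH catA H -catA.
have [n En] : exists n, n = (size g + size g).+1 by eexists.
have : size (wpow t n) <= size (g ++ wpow t' n ++ winv g).
  apply: size_reduced; first exact: cyc_wpow_reduced.
  by rewrite catA -HE -catA catwV cats0.
rewrite !size_cat size_winv !size_wpow.
have : n * (size t').+1 <= n * size t by rewrite leq_mul2l L orbT.
by rewrite mulnS; lia.
Qed.

(* For n large, no further cancellation occurs when t^n g is multiplied by t on the
   left, so that t (t^n g) = (t^n g) t' holds between traces. *)
Lemma twisted g t t' : cyc t -> cyc t' -> t ++ g ≡ g ++ t' ->
  exists n c, c ≡ wpow t n ++ g /\ teq (t ++ c) (c ++ t').
Proof.
move=> C C' H.
have SE : size t = size t'.
  apply/eqP; rewrite eqn_leq (cyc_size_le C C' H) /=.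
  apply: (@cyc_size_le (winv g)) => //.
  by apply: (@cat_cancel_l g); rewrite catA -H -catA catwV catKVw cats0.
pose f n := size (red (wpow t n ++ g)).
(* If every step up to [K] lost a letter, the length of [t^K g] would fall short of [K |t|] by more
   than [|g|], yet multiplying by [g^-1] must recover the reduced word [t^K]. *)
have [n Hn] : exists n, size t + f n <= f n.+1.
  have [K EK] : exists K, K = (size g + f 0).+1 by eexists.
  case: (boolP [exists n : 'I_K, size t + f n <= f n.+1]) => [/existsP [n]|].
    by exists n.
  rewrite negb_exists => /forallP N; exfalso.
  have L n : n <= K -> f n + n <= n * size t + f 0.
    elim: n => [|n IH] nK; first by rewrite addn0.
    have := N (Ordinal nK); rewrite -ltnNge /= => L1.
    by have := IH (ltnW nK); rewrite mulSn; lia.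
  have L2 : K * size t <= f K + size g.
    rewrite -size_wpow -(size_winv g) -size_cat.
    apply: size_reduced; first exact: cyc_wpow_reduced.
    by rewrite red_raag -catA catwV cats0.
  by have := L K (leqnn _); lia.
pose c := red (wpow t n ++ g).
have Ec : red (wpow t n.+1 ++ g) = t ++ c.
  have E : red (wpow t n.+1 ++ g) = foldr push c t.
    by rewrite wpowS -catA /red foldr_cat.
  by rewrite E; apply: foldr_push_full; rewrite -E.
exists n, c; split; first exact: red_raag.
have HE : t ++ c ≡ c ++ t'.
  rewrite /c red_raag -[X in _ ≡ X]catA -H !catA -wpowS wpowSr.
  exact: raag_refl.
apply: reduced_teq => //; first by rewrite -Ec; apply: red_reduced.
(* [c ++ t'] has the length of the reduced word [t ++ c], which represents the same element, so it
   is reduced as well. *)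
apply: reduced_full.
rewrite -(teq_size (raag_eq_red HE)) reduced_red -?Ec ?red_reduced //.
by rewrite Ec !size_cat SE addnC.
Qed.

Lemma mem_supp u w : (u \in supp w) = (0 < size (proj u u w)).
Proof.
rewrite size_filter -has_count; apply/mapP/hasP => [[y yw ->]|[y yw]].
  by exists y => //; rewrite eqxx.
by rewrite orbb => /eqP <-; exists y.
Qed.

(** Projection to a single vertex counts letters, and [c] contributes equally to both sides. *)
Lemma twisted_supp t c t' : teq (t ++ c) (c ++ t') -> supp t =i supp t'.
Proof.
move=> H u; have := congr1 size (H u u _); rewrite e_irr => /(_ isT).
by rewrite !proj_cat !size_cat addnC !mem_supp => /addnI ->.
Qed.

(** Suppose [u] and [v] do not commute. In the projection to this pair, the first [u] comes after
    all of [t] on the left, but at its place in [c] on the right; so [t] has no letter over [v]. *)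
Lemma twisted_link t c t' u v : teq (t ++ c) (c ++ t') ->
  v \in supp t -> u \in supp c -> u \notin supp t -> e u v.
Proof.
move=> H vt uc ut; apply: contraT => uv.
have ut' : u \notin supp t' by rewrite -(twisted_supp H).
have N r : u \notin supp r -> ~~ has (fun y => y.1 == u) (proj u v r).
  apply: contra => /hasP [y]; rewrite mem_filter => /andP [_ yr] /eqP <-.
  exact: map_f.
have := congr1 (find (fun y => y.1 == u)) (H u v uv).
rewrite !proj_cat !find_cat (negPf (N _ ut)).
have -> : has (fun y => y.1 == u) (proj u v c).
  case/mapP: uc => y yc E; apply/hasP; exists y; last by rewrite E.
  by rewrite mem_filter E eqxx.
move/eqP; rewrite -{2}[find _ _]add0n eqn_add2r size_eq0 => /eqP X0.
case/mapP: vt => y yt E; have : y \in proj u v t by rewrite mem_filter E eqxx orbT.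
by rewrite X0.
Qed.

Lemma comm_of_pow t n g c : comm t c -> c ≡ wpow t n ++ g -> comm t g.
Proof.
move=> H E; have -> : g ≡ winv (wpow t n) ++ c by rewrite E catVKw.
by apply: comm_cat => //; apply/comm_winv/comm_wpow/comm_refl.
Qed.

(** For the cyclically reduced core [t0], the projected equations say that powers commute with words
    in free monoids, where [wpow_comm_inv] passes to roots. *)
Lemma comm_root t b n : 0 < n -> comm (wpow t n) b -> comm t b.
Proof.
move=> n0; have [h [t0 [C E _]]] := cyc_conj t.
have -> : comm t b <-> comm t0 (cnj (winv h) b).
  by rewrite -(comm_conj h t0) conjVK E.
have -> : comm (wpow t n) b <-> comm (wpow t0 n) (cnj (winv h) b).
  by rewrite -(comm_conj h (wpow t0 n)) conjVK E conj_wpow.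
move: (cnj _ b) => {}b H.
have [N [c [Ec Tc]]] := twisted (cyc_wpow n C) (cyc_wpow n C) H.
have Tc' : teq (t0 ++ c) (c ++ t0).
  move=> u v uv; have := Tc u v uv; rewrite !proj_cat /proj filter_wpow.
  exact: wpow_comm_inv.
by apply: (comm_of_pow (teq_raag Tc')); rewrite Ec -wpowM.
Qed.

(** * Restriction to blocks of the support *)

Definition restr (P : pred T) w : word T := [seq y <- w | P y.1].

(** [P] is closed under non-commutation within [supp t], so the letters over a non-commuting pair
    are kept or dropped together. *)
Lemma restr_proj (P : pred T) t u v :
  {in supp t &, forall u v, ~~ e u v -> P u -> P v} -> ~~ e u v ->
  proj u v (restr P t) = [::] \/ proj u v (restr P t) = proj u v t.
Proof.
move=> HP uv; case E: (proj u v (restr P t)) => [|y r]; first by left.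
right; rewrite -E.
have : y \in proj u v (restr P t) by rewrite E inE eqxx.
rewrite !mem_filter => /and3P [Hy Py yt].
rewrite /proj /restr -filter_predI; apply: eq_in_filter => z zt /=.
rewrite andb_idr // => Hz.
have zs : z.1 \in supp t by apply: map_f.
have ys : y.1 \in supp t by apply: map_f.
apply: (HP y.1) => //; case/orP: Hy => /eqP ->; case/orP: Hz => /eqP ->;
  by rewrite ?e_irr // e_sym.
Qed.

(** Each projection of the restriction is empty or that of [t], so the twisted equation for [t] also
    holds for its restriction. *)
Lemma restr_comm (P : pred T) t b : cyc t ->
  {in supp t &, forall u v, ~~ e u v -> P u -> P v} ->
  comm t b -> comm (restr P t) b.
Proof.
move=> C HP H; have [N [c [Ec Tc]]] := twisted C C H.
have Tc' : teq (restr P t ++ c) (c ++ restr P t).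
  move=> u v uv; have := Tc u v uv; rewrite !proj_cat.
  by case: (restr_proj HP uv) => -> //; rewrite cats0.
have Ht : comm (restr P t) t.
  apply: teq_raag => u v uv; rewrite !proj_cat.
  by case: (restr_proj HP uv) => -> //; rewrite cats0.
have -> : b ≡ winv (wpow t N) ++ c by rewrite Ec catVKw.
apply: comm_cat; last exact: teq_raag.
exact/comm_winv/comm_wpow.
Qed.

Lemma restr_cyc (P : pred T) t : cyc t ->
  {in supp t &, forall u v, ~~ e u v -> P u -> P v} -> cyc (restr P t).
Proof.
move=> /forallP C HP; apply/forallP => u.
case: (boolP (u \in supp (restr P t))) => [us|ut].
  have -> : star u (restr P t ++ restr P t) = star u (t ++ t).
    suff E : star u (restr P t) = star u t by rewrite /star !filter_cat in E *; rewrite E.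
    rewrite /star /restr -filter_predI; apply: eq_in_filter => z zt /=.
    rewrite andb_idr // => uz.
    case/mapP: us => y; rewrite mem_filter => /andP [Py yt] uy.
    by apply: (HP u); rewrite ?uy ?map_f // -uy.
  exact: C.
rewrite -[star _ _]cats0 sorted_nocancel_cat //.
apply/allP => y; rewrite mem_filter mem_cat orbb => /andP [_ yt].
by apply: contraNneq ut => <-; apply: map_f.
Qed.

Lemma teq_split (P : pred T) w :
  (forall u v, u \in supp w -> v \in supp w -> P u -> ~~ P v -> e u v) ->
  teq w (restr P w ++ restr (predC P) w).
Proof.
move=> H u v uv; rewrite proj_cat.
have F Q : proj u v (restr Q w) = [seq y <- proj u v w | Q y.1].
  by rewrite /proj /restr -!filter_predI; apply: eq_filter => y /=; rewrite andbC.
rewrite !F; set X := proj u v w.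
have : all (fun y => P y.1) X \/ all (fun y => ~~ P y.1) X.
  case: (boolP (all (fun y => P y.1) X)) => [|/allPn [y yX Py]]; first by left.
  right; apply/allP => z zX; apply/negP => Pz.
  move: yX zX; rewrite !mem_filter => /andP [Hy yw] /andP [Hz zw].
  have := H _ _ (map_f fst zw) (map_f fst yw) Pz Py.
  by case/orP: Hy => /eqP ->; case/orP: Hz => /eqP ->;
    rewrite ?e_irr // ?(negPf uv) // e_sym (negPf uv).
case=> A.
  rewrite (all_filterP A) (_ : [seq y <- X | predC P y.1] = [::]) ?cats0 //.
  apply: filter_predC_nil.
  by apply: sub_all A => y /= ->.
rewrite (_ : [seq y <- X | P y.1] = [::]); first by rewrite (all_filterP A).
apply: filter_predC_nil.
by apply: sub_all A => y.
Qed.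

(** Letters in different classes of [k] commute, so the classes can be sorted one after the other.
    This serves the components of a support, the single letters of a clique, and the blocks of the
    three-vertex argument. *)
Lemma teq_partition (K : eqType) (k : T -> K) (ks : seq K) w : uniq ks ->
  (forall u, u \in supp w -> k u \in ks) ->
  (forall u v, u \in supp w -> v \in supp w -> k u != k v -> e u v) ->
  teq w (flatten [seq restr (fun u => k u == i) w | i <- ks]).
Proof.
elim: ks w => [|i ks IH] w /=.
  by case: w => // y w _ /(_ y.1); rewrite inE eqxx => /(_ isT).
case/andP=> iks uks Hk He.
apply: teq_trans (@teq_split (fun u => k u == i) w _) _.
  by move=> u v us vs /eqP ui vi; apply: He => //; rewrite ui eq_sym.
apply: teq_cat => //.
have Sub : {subset supp (restr (predC (fun u => k u == i)) w) <= supp w}.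
  by move=> u /mapP [y]; rewrite mem_filter => /andP [_ yw] ->; apply: map_f.
have := IH (restr (predC (fun u => k u == i)) w) uks.
have -> : [seq restr (fun u => k u == i0) (restr (predC (fun u => k u == i)) w) | i0 <- ks] =
    [seq restr (fun u => k u == i0) w | i0 <- ks].
  apply/eq_in_map => j jks; rewrite /restr -filter_predI; apply: eq_filter => y /=.
  by rewrite andb_idr // => /eqP ->; apply: contraNneq iks => <-.
apply; last by move=> u v /Sub us /Sub vs; apply: He.
move=> u us; have := Hk _ (Sub _ us); rewrite inE => /orP [/eqP ui|//].
case/mapP: us => y; rewrite mem_filter => /andP [/= yi _] uy.
by rewrite -uy ui eqxx in yi.
Qed.

(** * Pure elements *)

Lemma wpow_cat_comm a b n : comm a b -> wpow (a ++ b) n ≡ wpow a n ++ wpow b n.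
Proof.
move=> H; elim: n => // n IH; rewrite !wpowS IH -!catA.
apply: cat_raag_eq => //; rewrite !catA.
by apply: cat_raag_eq => //; apply: (@comm_wpow b a); apply: comm_sym.
Qed.

Lemma cyc_nontrivial t n : cyc t -> t != [::] -> 0 < n -> ~ wpow t n ≡ [::].
Proof.
move=> C t0 n0 H; have := size_reduced (cyc_wpow_reduced n C) H.
rewrite size_wpow leqn0 muln_eq0 size_eq0 (negPf t0) orbF.
by case: n n0 {H}.
Qed.

(** Both exponents are positive; the flag [b] carries their relative sign. *)
Definition parallel r s := exists m n (b : bool),
  [/\ 0 < m, 0 < n & wpow r m ≡ wpow (if b then winv s else s) n].

Lemma parallel_refl r : parallel r r.
Proof. by exists 1, 1, false. Qed.

Lemma parallel_sym r s : parallel r s -> parallel s r.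
Proof.
case=> m [n [b [m0 n0 H]]]; exists n, m, b; split=> //.
case: b H => H; last by rewrite H.
by rewrite -winv_wpow H -winv_wpow winvK.
Qed.

#[export] Instance parallel_raag_eq : Proper (raag_eq e ==> raag_eq e ==> iff) parallel.
Proof.
move=> a a' Ha b b' Hb.
by split=> [] [m [n [c [m0 n0 H]]]]; exists m, n, c; split=> //; move: H;
   case: c; rewrite Ha Hb.
Qed.

Lemma parallel_conj g r s : parallel r s -> parallel (cnj g r) (cnj g s).
Proof.
case=> m [n [b [m0 n0 H]]]; exists m, n, b; split=> //.
case: b H => H; rewrite -?conj_winv -!conj_wpow H; reflexivity.
Qed.

(** Connectedness of the non-commutation graph on [supp t], as an induction principle: a property
    that holds at one vertex and spreads along edges holds everywhere. *)
Definition connected t := forall Q : T -> Prop,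
  (exists2 u, u \in supp t & Q u) ->
  (forall u v, u \in supp t -> v \in supp t -> ~~ e u v -> Q u -> Q v) ->
  forall v, v \in supp t -> Q v.

Definition pure t := [/\ cyc t, t != [::] & connected t].

Definition gen u : word T := [:: (u, false)].

(* The vertices of the extension graph attached to the two elements commute and are
   distinct. *)
Definition far g t g' t' := forall u v, u \in supp t -> v \in supp t' ->
  comm (cnj g (gen u)) (cnj g' (gen v)) /\ ~ cnj g (gen u) ≡ cnj g' (gen v).

Lemma cyc_gen u : cyc (gen u).
Proof.
apply/forallP => v; rewrite /star /gen /=; case: (~~ e v u) => //=.
by rewrite /nocancel /= !andbF.
Qed.

Lemma conj_gen_inj w u v : gen u ≡ cnj w (gen v) -> u = v.
Proof.
move=> H; have : gen u ++ w ≡ w ++ gen v.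
  by rewrite H /cnj -!catA catVw !cats0.
case/(twisted (cyc_gen u) (cyc_gen v)) => N [c [_ /twisted_supp /(_ u)]].
by rewrite !inE eqxx => /esym /eqP.
Qed.

Lemma proj_letters (P : pred T) w u v : all (fun y => P y.1) w -> ~~ P v ->
  proj u v w = proj u u w.
Proof.
move=> A nv; apply: eq_in_filter => y /(allP A) Py; rewrite orbb.
by case: (y.1 =P v) => [E|_]; rewrite ?orbF // -E Py in nv *.
Qed.

Lemma proj_letters0 (P : pred T) w u v : all (fun y => P y.1) w ->
  ~~ P u -> ~~ P v -> proj u v w = [::].
Proof.
move=> A nu nv; rewrite (proj_letters u A nv).
apply/eqP; rewrite -size_eq0 -leqn0 leqNgt -mem_supp.
by apply: contra nu => /mapP [y /(allP A) Py ->].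
Qed.

Lemma projC u v w : proj u v w = proj v u w.
Proof. by apply: eq_filter => y; rewrite orbC. Qed.

Lemma all_supp (P : pred T) w : all (fun y => P y.1) w = all P (supp w).
Proof. by rewrite all_map. Qed.

(** In each non-commuting projection [t] and [c] commute, so their letter counts are proportional,
    and connectedness spreads one ratio over the whole support. The powers with exponents [nu v0 c]
    and [nu v0 t] then have commuting projections of equal length, hence equal ones. *)
Lemma connected_commute_pow t c : pure t -> teq (t ++ c) (c ++ t) ->
  {subset supp c <= supp t} -> exists m n, 0 < n /\ wpow t m ≡ wpow c n.
Proof.
case=> C t0 Ct H Sc.
have [v0 v0t] : exists v0, v0 \in supp t.
  by case: t t0 {C Ct H Sc} => // y r _; exists y.1; rewrite inE eqxx.
pose nu u w := count (fun y : T * bool => y.1 == u) w.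
have nuE u w : nu u w = size (proj u u w).
  by rewrite size_filter; apply: eq_count => y; rewrite orbb.
have nuP u v w : nu u w = count (fun y => y.1 == u) (proj u v w).
  rewrite count_filter; apply: eq_count => y /=.
  by case: (y.1 == u).
have nuP' u v w : nu v w = count (fun y => y.1 == v) (proj u v w).
  by rewrite projC -nuP.
have S u v w : u != v -> size (proj u v w) = nu u w + nu v w.
  move=> uv; rewrite size_filter -[RHS]count_predUI [X in _ = _ + X](_ : _ = 0) ?addn0 //.
  apply/eqP; rewrite -leqn0 leqNgt -has_count -all_predC; apply/allP => y _ /=.
  by case: eqP => //= ->.
clearbody nu.
have nu0 : 0 < nu v0 t by rewrite nuE -mem_supp.
have R : forall u, u \in supp t -> nu u c * nu v0 t = nu v0 c * nu u t.
  apply: Ct; first by exists v0.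
  move=> u v us vs uv Hu.
  have nuu : 0 < nu u t by rewrite nuE -mem_supp.
  have := H u v uv; rewrite !proj_cat => /(@comm_count_ratio _ (fun y => y.1 == u) (fun y => y.1 == v)).
  rewrite -!nuP -!nuP' => K.
  have {}K : nu u c * nu v t = nu v c * nu u t.
    apply: K; apply: leq_trans nuu _; rewrite (nuP u v); exact: count_size.
  by nia.
exists (nu v0 c), (nu v0 t); split=> //.
apply: teq_raag => u v uv; rewrite /proj !filter_wpow -!/(proj _ _ _).
have Ac : all (fun y => y.1 \in supp t) c by rewrite (all_supp [in supp t]); apply/allP.
have At : all (fun y => y.1 \in supp t) t by rewrite (all_supp [in supp t]); apply/allP.
have main u' v' : u' \in supp t -> v' \in supp t -> ~~ e u' v' ->
    wpow (proj u' v' t) (nu v0 c) = wpow (proj u' v' c) (nu v0 t).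
  move=> us vs uv'; apply: comm_size_eq.
    by apply: wpow_comm2; have := H u' v' uv'; rewrite !proj_cat.
  rewrite !size_wpow.
  case: (eqVneq u' v') => [->|nuv]; first by rewrite -!nuE -R // mulnC.
  by rewrite !S // !mulnDr -!R // !(mulnC (nu v0 t)).
case: (boolP (u \in supp t)) (boolP (v \in supp t)) => [us|us] [vs|vs].
- exact: main.
- by rewrite !(@proj_letters [in supp t]) // main ?e_irr.
- by rewrite !(projC u) !(@proj_letters [in supp t]) // main ?e_irr.
- rewrite !(@proj_letters0 [in supp t]) //.
  have W n : wpow [::] n = [::] :> word T by elim: n.
  by rewrite !W.
Qed.

(* Conjugate so that g = 1 and write s = cnj g' t'.  A reduced form c of t^N s splits
   as c1 d with c1 supported on supp t and d on its link, so s = b d with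
   b = t^-N c1.  As t' is connected, b or d is trivial. *)
Lemma pure_dichotomy g t g' t' : pure t -> pure t' ->
  comm (cnj g t) (cnj g' t') ->
  parallel (cnj g' t') (cnj g t) \/ far g t g' t'.
Proof.
move=> Pt Pt' H.
suff K h : comm t (cnj h t') -> parallel (cnj h t') t \/ far [::] t h t'.
  have [|Hp|F] := K (winv g ++ g').
  - by rewrite conjM -(comm_conj g) conjVK.
  - by left; have := parallel_conj g Hp; rewrite conjM conjVK.
  - right=> u v us vs; have [F1 F2] := F u v us vs.
    have E0 : cnj [::] (gen u) ≡ cnj (winv g) (cnj g (gen u)).
      by rewrite conjK; exact: raag_refl.
    rewrite E0 conjM in F1 F2; split; first by rewrite -(comm_conj (winv g)).
    by move=> F3; apply: F2; rewrite F3.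
have [C t0 Ct] := Pt; have [C' t0' Ct'] := Pt'.
move=> Hh; clear g g' H; rename h into g; rename Hh into H.
set s := cnj g t' in H.
have [N [c [Ec Tc]]] := twisted C C H.
pose S : pred T := [in supp t]; pose L : pred T := fun u => all (e u) (supp t).
have SL u : u \in supp c -> ~~ S u -> L u.
  by move=> uc us; apply/allP => v vs; apply: (twisted_link Tc).
have eSL u v : S u -> L v -> e v u by move=> us /allP; apply.
have nSL u : S u -> L u -> False by move=> us /(eSL _ _ us); rewrite e_irr.
pose c1 := restr S c; pose d := restr (predC S) c.
have Tcd : teq c (c1 ++ d).
  apply: teq_split => u v us vs Su nSv; rewrite e_sym; apply: eSL => //.
  exact: SL.
pose b := winv (wpow t N) ++ c1.
have Es : s ≡ b ++ d by rewrite /b -catA -(teq_raag Tcd) Ec catVKw.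
have At : all (fun y => S y.1) t by rewrite (all_supp S); apply/allP.
have Ac1 : all (fun y => S y.1) c1 by rewrite /c1 /restr; apply: filter_all.
have Ab : all (fun y => S y.1) b.
  by rewrite all_cat Ac1 winv_letters (all_wpow _ At).
have Ad : all (fun y => L y.1) d.
  apply/allP => y; rewrite mem_filter => /andP [nS yc]; apply: SL => //.
  exact: map_f.
have cSL w w' : all (fun y => S y.1) w -> all (fun y => L y.1) w' -> comm w w'.
  move=> Aw Aw'; apply: comm_letters => y z /(allP Aw) Sy /(allP Aw') Lz.
  by left; rewrite e_sym; apply: eSL.
have [k [b' [Cb Eb /(_ _ Ab) /andP [Ak Ab']]]] := cyc_conj b.
have [h [d' [Cd Ed /(_ _ Ad) /andP [Ah Ad']]]] := cyc_conj d.
(* Letters over [S] and [L] commute. A star over [u] in [S] sees only [b'], over [u] in [L] only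
   [d'], and elsewhere it contains no letter over [u]. *)
have Cm : cyc (b' ++ d').
  apply/forallP => u; rewrite /star !filter_cat -/(star u b') -/(star u d').
  have S0 (P : pred T) w : all (fun y => P y.1) w -> (forall v, P v -> e u v) -> star u w = [::].
    move=> A K; apply: filter_predC_nil.
    by apply: sub_all A => y /= /K ->.
  case: (boolP (S u)) => Su.
    rewrite (S0 L d') // ?cats0; last by move=> v; rewrite e_sym; apply: eSL.
    by have := forallP Cb u; rewrite /star filter_cat.
  case: (boolP (L u)) => Lu.
    rewrite (S0 S b') //; last by move=> v Sv; apply: eSL.
    by have := forallP Cd u; rewrite /star filter_cat.
  rewrite -!filter_cat -[filter _ _]cats0 sorted_nocancel_cat //.
  apply/allP => y; rewrite mem_filter => /andP [_].
  have : all (fun y => S y.1 || L y.1) ((b' ++ d') ++ b' ++ d').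
    rewrite !all_cat; have -> : all (fun y => S y.1 || L y.1) b'.
      by apply: sub_all Ab' => z /= ->.
    have -> // : all (fun y => S y.1 || L y.1) d'.
    by apply: sub_all Ad' => z /= ->; rewrite orbT.
  move/allP => A /A; apply: contraTneq => ->; by rewrite negb_or Su.
have Em : s ≡ cnj (k ++ h) (b' ++ d').
  have E1 : cnj h b' ≡ b'.
    have := cSL _ _ Ab' Ah; rewrite /comm /raag_commute /cnj catA => <-.
    by rewrite -catA catwV cats0.
  have E2 : cnj k d ≡ d.
    have := cSL _ _ Ak Ad; rewrite /comm /raag_commute /cnj catA => ->.
    by rewrite -catA catwV cats0.
  rewrite conjM; have -> : cnj h (b' ++ d') ≡ b' ++ d by rewrite conj_cat E1 -Ed.
  by rewrite conj_cat E2 -Eb Es.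
move: (k ++ h) Em => kh Em; pose g' := winv kh ++ g.
have Hg' : (b' ++ d') ++ g' ≡ g' ++ t'.
  rewrite /g' -[X in _ ≡ X]catA.
  have -> : g ++ t' ≡ s ++ g by rewrite /s /cnj -!catA catVw cats0.
  by rewrite Em /cnj; move: (b' ++ d') => m; rewrite -!catA catVKw.
have [N2 [c2 [Ec2 Tc2]]] := twisted Cm C' Hg'.
have Sm := twisted_supp Tc2.
have memS w : all (fun y => S y.1) w -> forall u, u \in supp w -> S u.
  by move=> A u /mapP [y /(allP A) ? ->].
have memL w : all (fun y => L y.1) w -> forall u, u \in supp w -> L u.
  by move=> A u /mapP [y /(allP A) ? ->].
(* [supp t'] is the union of the supports of [b'] and [d'], with no non-commuting pair between them;
   being connected, it lies in [S] once it meets [S]. *)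
have allS : (exists2 u, u \in supp t' & S u) -> forall u, u \in supp t' -> S u.
  move=> Hu; apply: Ct' => // u v us; rewrite -Sm supp_cat mem_cat => vs uv Su.
  case/orP: vs => [/(memS _ Ab') //|/(memL _ Ad') Lv].
  by rewrite e_sym (eSL _ _ Su Lv) in uv.
case: (boolP (has S (supp t'))) => [/hasP /allS St'|nS].
  left; have d0 : d' = [::].
    case E: d' => [|y r] //; exfalso.
    have yd : y.1 \in supp d' by rewrite E inE eqxx.
    apply: (@nSL y.1); last exact: (memL _ Ad').
    by apply: St'; rewrite -Sm supp_cat mem_cat yd orbT.
  have Esb : s ≡ b by rewrite Es Ed d0 conj_nil cats0.
  (* Filtering the twisted equation by [S] leaves [t] intact and turns [c] into [c1]. *)
  have Tc1 : teq (t ++ c1) (c1 ++ t).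
    have Rt : restr S t = t by apply/all_filterP.
    move=> u v uv; have := congr1 (restr S) (Tc u v uv).
    have F w : restr S (proj u v w) = proj u v (restr S w).
      by rewrite /restr /proj -!filter_predI; apply: eq_filter => y /=; rewrite andbC.
    by rewrite !F /restr !filter_cat -!/(restr _ _) Rt.
  have [|m [n [n0 Emn]]] := connected_commute_pow Pt Tc1.
    by move=> u; apply: memS.
  have Esn : wpow s n ≡ winv (wpow t (N * n)) ++ wpow t m.
    rewrite Esb /b wpow_cat_comm; last first.
      apply: comm_sym; apply: comm_winv; apply: comm_wpow; apply: comm_sym.
      exact: teq_raag.
    by rewrite -Emn -winv_wpow -wpowM.
  have sn0 : ~ wpow s n ≡ [::].
    move=> E; apply: (cyc_nontrivial C' t0' n0).
    by rewrite -(conjK g (wpow t' n)) conj_wpow -/s E conj_nil.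
  (* [s^n = t^(m - N n)], and this exponent is not zero because [s^n] is non-trivial. *)
  case: (ltngtP m (N * n)) => mn.
  - exists n, (N * n - m), true; split; rewrite ?subn_gt0 //.
    rewrite Esn -{1}(subnK (ltnW mn)) wpowD winv_cat.
    rewrite -winv_wpow.
    rewrite -(subnK (ltnW mn)) in Esn.
    apply: (@cat_cancel_r (winv (wpow t m))); rewrite -catA catwV cats0.
    by rewrite -!winv_cat -!wpowD addnC.
  - exists n, (m - N * n), false; split; rewrite ?subn_gt0 //.
    by rewrite Esn -{1}(subnKC (ltnW mn)) wpowD catVKw.
  - by case: sn0; rewrite Esn mn catVw.
right=> u v us vs.
have b0 : b' = [::].
  case E: b' => [|y r] //; exfalso; case/negP: nS; apply/hasP.
  have yb : y.1 \in supp b' by rewrite E inE eqxx.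
  exists y.1; last exact: (memS _ Ab').
  by rewrite -Sm supp_cat mem_cat yb.
have Esd : s ≡ cnj h d' by rewrite Es Eb b0 conj_nil Ed.
have Hg : d' ++ (winv h ++ g) ≡ (winv h ++ g) ++ t'.
  rewrite -[X in _ ≡ X]catA.
  have -> : g ++ t' ≡ s ++ g by rewrite /s /cnj -!catA catVw cats0.
  by rewrite Esd /cnj -!catA catVKw.
have [N3 [c3 [Ec3 Tc3]]] := twisted Cd C' Hg.
have vd : v \in supp d' by rewrite (twisted_supp Tc3).
(* The letters of [c3] outside [supp d'] commute with [v], so conjugating [v] by [g] amounts to
   conjugating it by a word over [L]. *)
pose c4 := restr [in supp d'] c3; pose c5 := restr (predC [in supp d']) c3.
have Tc45 : teq c3 (c4 ++ c5).
  apply: teq_split => x y xc yc xd yd; rewrite e_sym.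
  exact: (twisted_link Tc3).
have Eg : g ≡ (h ++ winv (wpow d' N3) ++ c4) ++ c5.
  by rewrite -!catA -(teq_raag Tc45) Ec3 catVKw catKVw.
have Ev : cnj g (gen v) ≡ cnj (h ++ winv (wpow d' N3) ++ c4) (gen v).
  rewrite Eg conjM; suff -> : cnj c5 (gen v) ≡ gen v by [].
  have : comm c5 (gen v).
    apply: comm_letters => y z; rewrite mem_filter => /andP [/= yd yc].
    rewrite /gen inE => /eqP ->.
    by left; apply: (twisted_link Tc3 vd) => //; apply: map_f.
  by rewrite /comm /raag_commute /cnj catA => ->; rewrite -catA catwV cats0.
have Ax : all (fun y => L y.1) (h ++ winv (wpow d' N3) ++ c4).
  rewrite !all_cat Ah winv_letters (all_wpow _ Ad') //=.
  apply/allP => y; rewrite mem_filter => /andP [yd _]; exact: (memL _ Ad').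
move: (h ++ _ ++ _) Ev Ax => w Ev Ax.
rewrite Ev; have -> : cnj [::] (gen u) = gen u by [].
split.
  apply: cSL; first by rewrite /= andbT.
  by rewrite /cnj !all_cat winv_letters Ax /= (memL _ Ad').
by move=> /conj_gen_inj uv; apply: (@nSL u) => //; rewrite uv; apply: (memL _ Ad').
Qed.

End Raag.

(** * Pure factors and common roots *)

Section Blocks.
Variables (T : finType) (e : rel T).
Hypotheses (e_sym : symmetric e) (e_irr : irreflexive e).
Implicit Types (w s : word T).
Local Notation "a ≡ b" := (raag_eq e a b) (at level 70).
#[local] Instance conj_proper : Proper (raag_eq e ==> raag_eq e ==> raag_eq e) (@cnj T) := conj_raag_eq e_sym.

Definition cval (p : word T * word T) := cnj p.1 p.2.

(** Letters of [supp t] have equal roots in [r] exactly when they lie in one component of the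
    non-commutation graph; a block is the part of [t] over one component. *)
Lemma pure_restr_root t u (r := [rel u v | [&& u \in supp t, v \in supp t & ~~ e u v]]) :
  cyc e t -> u \in supp t -> pure e (restr (fun v => fingraph.root r v == fingraph.root r u) t).
Proof.
move=> C ut.
have rs : symmetric r by move=> x y /=; rewrite e_sym andbA (andbC (x \in _)) -andbA.
have cs := sym_connect_sym rs.
have HP : {in supp t &, forall x y, ~~ e x y ->
    fingraph.root r x == fingraph.root r u -> fingraph.root r y == fingraph.root r u}.
  move=> x y xt yt xy; have : fingraph.root r x == fingraph.root r y.
    by rewrite (root_connect cs) connect1 //= xt yt.
  by move/eqP->.
have memE x : x \in supp (restr (fun v => fingraph.root r v == fingraph.root r u) t) =
    (x \in supp t) && (fingraph.root r x == fingraph.root r u).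
  apply/mapP/andP => [[y]|[/mapP [y yt ->] H]].
    by rewrite mem_filter => /andP [H yt] ->; rewrite map_f.
  by exists y => //; rewrite mem_filter H.
split; first exact: restr_cyc.
  by apply/eqP => E; have := memE u; rewrite E ut eqxx.
move=> Q [x]; rewrite memE => /andP [xt xu] Qx HQ y; rewrite memE => /andP [yt yu].
have : connect r x y by rewrite -(root_connect cs) (eqP xu) eq_sym.
case/connectP => p; elim: p x xt xu Qx => [|z p IH] x xt xu Qx /=; first by move=> _ ->.
case/andP=> /and3P [_ zt xz] pp yE.
have zu : fingraph.root r z == fingraph.root r u by apply: (HP x).
by apply: (IH z) => //; apply: (HQ x); rewrite ?memE ?xt ?zt.
Qed.

(** The factors are the conjugated blocks of the cyclically reduced core. By [restr_comm] they
    commute with whatever commutes with [w], in particular with one another. *)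
Lemma block_decomposition w : exists bs : seq (word T * word T),
  [/\ forall p, p \in bs -> pure e p.2,
      w ≡ flatten [seq cval p | p <- bs] &
      forall b p, comm e w b -> p \in bs -> comm e (cval p) b].
Proof.
have [g [t [C E _]]] := cyc_conj e_sym e_irr w.
pose r := [rel u v | [&& u \in supp t, v \in supp t & ~~ e u v]].
have rs : symmetric r by move=> x y /=; rewrite e_sym andbA (andbC (x \in _)) -andbA.
have cs := sym_connect_sym rs.
have cl x y : x \in supp t -> y \in supp t -> ~~ e x y -> fingraph.root r x = fingraph.root r y.
  by move=> xt yt xy; apply/eqP; rewrite (root_connect cs) connect1 //= xt yt.
pose ks := undup (map (fingraph.root r) (supp t)).
pose blk k := (g, restr (fun v => fingraph.root r v == k) t).
exists (map blk ks); split.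
- move=> p /mapP [k]; rewrite mem_undup => /mapP [u ut ->] ->.
  exact: pure_restr_root.
- rewrite E -map_comp.
  rewrite {1}(teq_raag e_sym e_irr (@teq_partition T e e_sym e_irr _ (fingraph.root r) ks t (undup_uniq _) _ _)).
  + by rewrite conj_flatten -map_comp; reflexivity.
  + by move=> u ut; rewrite mem_undup map_f.
  + move=> u v ut vt; apply: contraNT => uv; apply/eqP; exact: cl.
- move=> b p H /mapP [k _ ->]; rewrite /cval /=.
  rewrite -(conjVK e g b) (comm_conj e_sym).
  apply: (restr_comm e_sym e_irr) => //.
    by move=> x y xt yt xy; rewrite (cl x y).
  by rewrite -(comm_conj e_sym g) conjVK -E.
Qed.

(** Commutation passes to powers, and by [comm_root] from a power back to its root. *)
Lemma parallel_comm r s b : parallel e r s -> comm e r b -> comm e s b.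
Proof.
case=> m [n [c [m0 n0 H]]] rb.
have : comm e (wpow r m) b by apply: comm_sym; apply: comm_wpow; apply: comm_sym.
rewrite H => /(comm_root e_sym e_irr n0).
case: c {H} => // H; apply: comm_sym; rewrite -[s]winvK.
by apply: comm_winv; apply: comm_sym.
Qed.

(** Induction on [D]: when [p^m] is a power of a representative, [M] is multiplied by [m]; otherwise
    [p] itself becomes a representative. *)
Lemma common_roots (D : seq (word T * word T)) :
  exists (reps : seq (word T * word T)) M,
  [/\ 0 < M, {subset reps <= D},
      forall i j, i < j -> j < size reps ->
        ~ parallel e (cval (nth ([::], [::]) reps i)) (cval (nth ([::], [::]) reps j)) &
      forall p, p \in D -> exists c b n,
        [/\ c \in reps, parallel e (cval p) (cval c) &
            wpow (cval p) M ≡ wpow (if b then winv (cval c) else cval c) n]].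
Proof.
elim: D => [|p D [reps [M [M0 sub np H]]]]; first by exists [::], 1.
case: (classic (exists2 c, c \in reps & parallel e (cval p) (cval c))) => [[c cr pc]|N].
  have [m [n [b [m0 n0 E]]]] := pc.
  exists reps, (m * M); split=> //; first by rewrite muln_gt0 m0.
    by move=> q /sub qD; rewrite inE qD orbT.
  move=> q; rewrite inE => /orP [/eqP ->|qD].
    exists c, b, (n * M); split=> //.
    by rewrite !wpowM E; reflexivity.
  have [c' [b' [k [cr' pc' E']]]] := H q qD.
  exists c', b', (k * m); split=> //.
  by rewrite mulnC !wpowM E'; reflexivity.
exists (p :: reps), M; split=> //.
- by move=> q; rewrite !inE => /orP [->//|/sub ->]; rewrite orbT.
- move=> [|i] [|j] //= ij jr; last exact: np.
  move=> P; apply: N; exists (nth ([::], [::]) reps j) => //.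
  exact: mem_nth.
- move=> q; rewrite inE => /orP [/eqP ->|qD].
    exists p, false, M; rewrite inE eqxx; split=> //; exact: (parallel_refl e).
  have [c' [b' [k [cr' pc' E']]]] := H q qD.
  by exists c', b', k; rewrite inE cr' orbT.
Qed.

End Blocks.

(** * Homomorphisms and actions *)

Section Hom.
Variables (TL TG : finType).

Lemma hom_ext_cat (phi : TL -> word TG) w s :
  hom_ext phi (w ++ s) = hom_ext phi w ++ hom_ext phi s.
Proof. by rewrite /hom_ext map_cat flatten_cat. Qed.

Lemma hom_ext_winv (phi : TL -> word TG) w :
  hom_ext phi (winv w) = winv (hom_ext phi w).
Proof.
elim: w => // x w IH; rewrite winv_cons -cats1 hom_ext_cat IH.
rewrite -[x :: w]cat1s hom_ext_cat winv_cat; congr (_ ++ _).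
by case: x => u [] /=; rewrite /hom_ext /= !cats0 ?winvK.
Qed.

Lemma hom_ext_wpow (phi : TL -> word TG) w n :
  hom_ext phi (wpow w n) = wpow (hom_ext phi w) n.
Proof. by elim: n => // n IH; rewrite !wpowS hom_ext_cat IH. Qed.

Lemma hom_ext_gen (phi : TL -> word TG) u b :
  hom_ext phi [:: (u, b)] = if b then winv (phi u) else phi u.
Proof. by rewrite /hom_ext /= cats0. Qed.

Lemma hom_ext_congr (eG : rel TG) (phi phi' : TL -> word TG) w :
  symmetric eG -> (forall u, raag_eq eG (phi u) (phi' u)) ->
  raag_eq eG (hom_ext phi w) (hom_ext phi' w).
Proof.
move=> eGs H; elim: w => // [[u b] w] IH.
rewrite -cat1s !hom_ext_cat !hom_ext_gen; apply: cat_raag_eq => //.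
by case: b => //; apply: winv_raag_eq.
Qed.

Lemma hom_ext_raag (eL : rel TL) (eG : rel TG) (phi : TL -> word TG) w s :
  (forall u v, eL u v -> comm eG (phi u) (phi v)) ->
  raag_eq eL w s -> raag_eq eG (hom_ext phi w) (hom_ext phi s).
Proof.
move=> H; elim=> [?|? ? _ ?|? ? ? _ H1 _ H2|s1 s2 x b|s1 s2 x y b c exy].
- exact: raag_refl.
- exact: raag_sym.
- exact: raag_trans H1 H2.
- rewrite !hom_ext_cat; apply: cat_raag_eq => //.
  rewrite -[hom_ext phi s2]cat0s; apply: cat_raag_eq => //.
  rewrite -(cat1s (x, b)) hom_ext_cat !hom_ext_gen.
  by case: b; [exact: catVw | exact: catwV].
- rewrite !hom_ext_cat; apply: cat_raag_eq => //; apply: cat_raag_eq => //.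
  rewrite -(cat1s (x, b) [:: (y, c)]) -(cat1s (y, c) [:: (x, b)]) !hom_ext_cat !hom_ext_gen.
  have K := H _ _ exy.
  have K' : comm eG (phi x) (if c then winv (phi y) else phi y).
    by case: c => //; apply: comm_winv.
  by case: b => //; exact: (comm_sym (comm_winv (comm_sym K'))).
Qed.

End Hom.

Lemma hom_ext_comp (T1 T2 T3 : finType) (f : T2 -> word T3) (g : T1 -> word T2) w :
  hom_ext f (hom_ext g w) = hom_ext (fun u => hom_ext f (g u)) w.
Proof.
elim: w => // [[u b] w] IH.
rewrite -cat1s !hom_ext_cat IH !hom_ext_gen; congr (_ ++ _).
by rewrite cats0; case: b => //=; rewrite hom_ext_winv.
Qed.

(** * Powers of a homomorphism through common roots *)

Section CliqueForm.
Variables (TL TG : finType) (eL : rel TL) (eG : rel TG) (phi : TL -> word TG).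
Hypotheses (eG_sym : symmetric eG) (eG_irr : irreflexive eG).
Local Notation "a ≡ b" := (raag_eq eG a b) (at level 70).

(** The [z c] represent the parallel classes of all blocks of all [phi i]. The blocks of one image
    commute, so its [M]-th power is the product of theirs, each a power of some [z c]; [psi i]
    records this product as a word in the symbols [c]. *)
Lemma clique_form : exists m (z : 'I_m -> word TG * word TG) (psi : TL -> word 'I_m) M,
  [/\ 0 < M, forall c, pure eG (z c).2,
      forall c d, c != d -> ~ parallel eG (cval (z c)) (cval (z d)),
      forall i, wpow (phi i) M ≡ hom_ext (fun c => cval (z c)) (psi i) &
      forall i j, comm eG (phi i) (phi j) -> forall c d, c \in supp (psi i) ->
        d \in supp (psi j) -> comm eG (cval (z c)) (cval (z d))].
Proof.
have /fin_all_exists [bs Hbs] := fun i => block_decomposition eG_sym eG_irr (phi i).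
pose D := flatten [seq bs i | i <- enum TL].
have inD i p : p \in bs i -> p \in D.
  by move=> pi; apply/flattenP; exists (bs i) => //; apply: map_f; rewrite mem_enum.
have pureD p : p \in D -> pure eG p.2.
  by case/flattenP=> _ /mapP [i _ ->]; have [H _ _] := Hbs i; apply: H.
have [reps [M [M0 sub np H]]] := common_roots eG D.
pose z (c : 'I_(size reps)) := nth ([::], [::]) reps c.
have zr c : z c \in reps by apply: mem_nth.
have L (l : seq (word TG * word TG)) : {subset l <= D} ->
    (forall p q, p \in l -> q \in l -> comm eG (cval p) (cval q)) ->
    exists2 w : word 'I_(size reps),
      wpow (flatten [seq cval p | p <- l]) M ≡ hom_ext (fun c => cval (z c)) w &
      forall c, c \in supp w -> exists2 p, p \in l & parallel eG (cval p) (cval (z c)).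
  elim: l => [|p l IH] Hl Hc.
    by exists [::] => //=; elim: (M) => //.
  have [||w Hw Hp] := IH.
  - by move=> q ql; apply: Hl; rewrite inE ql orbT.
  - by move=> q r ql rl; apply: Hc; rewrite inE ?ql ?rl orbT.
  have [|c [b [n [cr pc En]]]] := H p; first by apply: Hl; rewrite inE eqxx.
  have ic : index c reps < size reps by rewrite index_mem.
  have zc : z (Ordinal ic) = c by rewrite /z /= nth_index.
  exists (wpow [:: (Ordinal ic, b)] n ++ w).
    rewrite hom_ext_cat hom_ext_wpow hom_ext_gen zc -Hw -En /=.
    apply: wpow_cat_comm; apply: comm_flatten => _ /mapP [q ql ->].
    by apply: Hc; rewrite inE ?eqxx ?ql ?orbT.
  move=> d; rewrite supp_cat mem_cat => /orP [dn|/Hp [q ql qd]]; last first.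
    by exists q => //; rewrite inE ql orbT.
  exists p; first by rewrite inE eqxx.
  suff -> : d = Ordinal ic by rewrite zc.
  exact: supp_wpow1 dn.
have bc i p q : p \in bs i -> q \in bs i -> comm eG (cval p) (cval q).
  move=> pi qi; have [_ _ K] := Hbs i.
  exact: K _ _ (comm_sym (K _ _ (comm_refl _ _) qi)) pi.
have /fin_all_exists [psi Hpsi] : forall i, exists w : word 'I_(size reps),
      wpow (phi i) M ≡ hom_ext (fun c => cval (z c)) w /\
      forall c, c \in supp w -> exists2 p, p \in bs i & parallel eG (cval p) (cval (z c)).
  move=> i; have [w H1 H2] := L (bs i) (inD i) (bc i).
  exists w; split=> //; rewrite -H1; have [_ E _] := Hbs i.
  by rewrite E; reflexivity.
exists (size reps), z, psi, M; split=> //.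
- by move=> c; apply/pureD/sub.
- move=> c d cd; case: (ltngtP c d) => [l|l|/ord_inj E]; last by rewrite E eqxx in cd.
    exact: np.
  by move/(parallel_sym eG_sym); apply: np.
- by move=> i; have [] := Hpsi i.
- move=> i j ij c d ci dj.
  have [_ /(_ c ci) [p pi pc]] := Hpsi i; have [_ /(_ d dj) [q qj qd]] := Hpsi j.
  apply: (parallel_comm eG_sym eG_irr pc); apply: comm_sym.
  apply: (parallel_comm eG_sym eG_irr qd).
  have [_ _ Ki] := Hbs i; have [_ _ Kj] := Hbs j.
  apply: Kj qj; apply: comm_sym; exact: Ki pi.
Qed.

End CliqueForm.

(** * Actions, used to show that elements are non-trivial *)

Section Action.
Variables (T : finType) (e : rel T) (X : Type) (act : T -> bool -> X -> X).
Hypotheses (actK : forall u b x, act u b (act u (~~ b) x) = x)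
  (actC : forall u v b c x, e u v -> act u b (act v c x) = act v c (act u b x)).

Definition actw (w : word T) (x : X) := foldr (fun l => act l.1 l.2) x w.

Lemma actw_cat w s x : actw (w ++ s) x = actw w (actw s x).
Proof. exact: foldr_cat. Qed.

Lemma actw_raag w s : raag_eq e w s -> forall x, actw w x = actw s x.
Proof.
elim=> [?|? ? _ H|? ? ? _ H1 _ H2|s1 s2 u b|s1 s2 u v b c euv] x //.
- by rewrite H1.
- by rewrite !actw_cat /= actK.
- by rewrite !actw_cat /= actC.
Qed.

Lemma actw_winvK w x : actw w (actw (winv w) x) = x.
Proof. by rewrite -actw_cat (actw_raag (catwV e w)). Qed.

Lemma actw_wpow w n x : actw (wpow w n) x = iter n (actw w) x.
Proof. by elim: n => // n IH; rewrite wpowS actw_cat IH. Qed.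

End Action.

(** * Iterated commutators *)

Definition commw (T : finType) (a b : word T) := a ++ b ++ winv a ++ winv b.

Lemma hom_ext_commw (T T' : finType) (phi : T -> word T') a b :
  hom_ext phi (commw a b) = commw (hom_ext phi a) (hom_ext phi b).
Proof. by rewrite /commw !hom_ext_cat !hom_ext_winv. Qed.

Lemma hom_ext_foldl_commw (T T' : finType) (phi : T -> word T') a us :
  hom_ext phi (foldl (@commw T) a us) =
  foldl (@commw T') (hom_ext phi a) (map (hom_ext phi) us).
Proof. by elim: us a => //= u us IH a; rewrite IH hom_ext_commw. Qed.

Lemma restr_commw (T : finType) (P : pred T) a b :
  restr P (commw a b) = commw (restr P a) (restr P b).
Proof. by rewrite /commw /restr !filter_cat !(filter_winv P). Qed.

Lemma restr_foldl_commw (T : finType) (P : pred T) a us :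
  restr P (foldl (@commw T) a us) = foldl (@commw T) (restr P a) (map (restr P) us).
Proof. by elim: us a => //= u us IH a; rewrite IH restr_commw. Qed.

(** A trivial entry makes its commutator trivial, and further commutators of a trivial element stay
    trivial. *)
Lemma foldl_commw_trivial (T : finType) (e : rel T) a us : symmetric e ->
  (exists2 u, u \in us & raag_eq e u [::]) -> raag_eq e (foldl (@commw T) a us) [::].
Proof.
move=> e_sym.
have P0 := winv_raag_eq e_sym.
have C1 b : raag_eq e (commw [::] b) [::] by rewrite /commw /= catwV.
have C2 b u : raag_eq e u [::] -> raag_eq e (commw b u) [::].
  by move=> H; rewrite /commw H /= !cats0 catwV.
have N b us' : raag_eq e b [::] -> raag_eq e (foldl (@commw T) b us') [::].
  elim: us' b => //= u us' IH b H; apply: IH.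
  by rewrite /commw H catwV.
elim: us a => [|v us IH] a [u]; first by [].
rewrite inE => /orP [/eqP ->|uus] H /=; first by apply: N; apply: C2.
by apply: IH; exists u.
Qed.

(** * Chains of clashing symbols *)

Section Reach.
Variables (TL TB : finType) (eL : rel TL) (eB : rel TB) (psi : TL -> word TB).
Variable M : nat.
Hypotheses (M_gt0 : 0 < M) (eL_sym : symmetric eL) (eL_irr : irreflexive eL) (eB_sym : symmetric eB) (eB_irr : irreflexive eB).
(** [psi u] stands for the [M]-th power of the image of [u], so injectivity is available for words
    in the [M]-th powers of the generators. *)
Hypothesis psi_inj : forall W, raag_eq eB (hom_ext psi W) [::] ->
  raag_eq eL (hom_ext (fun u => wpow (gen u) M) W) [::].
(** The case [i = j] says that [psi i] is supported on a clique. *)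
Hypothesis psi_comm : forall i j, eL i j || (i == j) -> forall c d,
  c \in supp (psi i) -> d \in supp (psi j) -> eB c d \/ c = d.

Local Notation pw := (fun u => wpow (gen u) M).
#[local] Instance winv_proper : Proper (raag_eq eB ==> raag_eq eB) (@winv TB) := winv_raag_eq eB_sym.

Definition clash c d := (c != d) && ~~ eB c d.

Lemma clash_sym c d : clash c d = clash d c.
Proof. by rewrite /clash eq_sym eB_sym. Qed.

Lemma clashPn c d : ~~ clash c d -> eB c d \/ c = d.
Proof. by rewrite /clash negb_and !negbK => /orP [/eqP|]; [right|left]. Qed.

Section Chain.
Variables (x : nat -> TL) (n : nat).
Hypothesis xC : forall i j, i.+1 < j -> j <= n.+1 -> eL (x i) (x j).

Fixpoint reach j : pred TB :=
  match j with
  | 0 => [in supp (psi (x 0))]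
  | i.+1 => fun d => (d \in supp (psi (x i.+1))) && [exists c, reach i c && clash c d]
  end.

Lemma reach_supp j c : reach j c -> c \in supp (psi (x j)).
Proof. by case: j => //= j /andP []. Qed.

Definition chain_word j := foldl (@commw TL) (gen (x 0)) [seq gen (x i) | i <- iota 1 j].

Lemma chain_wordS j : chain_word j.+1 = commw (chain_word j) (gen (x j.+1)).
Proof. by rewrite /chain_word -{1}(addn1 j) iotaD map_cat foldl_cat /= add1n. Qed.

(* The letters of psi x_{j+1} that are not reachable commute with all the letters
   occurring so far, hence drop out of the commutator. *)
Lemma chain_word_reach j : j <= n.+1 -> exists V : word TB,
  [/\ raag_eq eB (hom_ext psi (chain_word j)) V,
   forall c, c \in supp V -> exists2 i, i <= j & reach i c &
   0 < j -> (forall c, ~~ reach j c) -> raag_eq eB V [::]].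
Proof.
elim: j => [|j IH] jn.
  exists (psi (x 0)); split=> //; first by rewrite /chain_word /= hom_ext_gen.
  by move=> c cs; exists 0.
have [V [HV RV _]] := IH (ltnW jn).
pose a := psi (x j.+1); pose r := restr (reach j.+1) a.
pose s := restr (predC (reach j.+1)) a.
have Ea : raag_eq eB a (r ++ s).
  apply: teq_raag => //; apply: teq_split => // u v ua va ru rv.
  have jj : eL (x j.+1) (x j.+1) || (x j.+1 == x j.+1) by rewrite eqxx orbT.
  have [//|uv] := psi_comm jj ua va.
  by rewrite -uv ru in rv.
have sub y (P : pred TB) : y \in restr P a -> y.1 \in supp a.
  by rewrite mem_filter => /andP [_]; apply: map_f.
(* If [z] is reachable at stage [j], a clash would make [y] reachable; if at an earlier stage [i],
   then [x i] and [x j.+1] commute. *)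
have CsV : comm eB s V.
  apply: comm_letters => y z ys /(map_f fst) /RV [i].
  have ya := sub _ _ ys; rewrite leq_eqVlt => /orP [/eqP -> Rj|ij Ri].
    move: ys; rewrite mem_filter => /andP [/= + _].
    rewrite -/a ya /= negb_exists => /forallP /(_ z.1); rewrite Rj /= clash_sym.
    exact: clashPn.
  apply: (@psi_comm (x j.+1) (x i)) => //; last exact: reach_supp.
  by rewrite eL_sym xC.
have E : raag_eq eB (hom_ext psi (chain_word j.+1)) (commw V r).
  rewrite chain_wordS hom_ext_commw hom_ext_gen /commw HV -/a Ea winv_cat.
  rewrite -!catA; do 2!apply: cat_raag_eq => //.
  have -> : raag_eq eB (s ++ winv V ++ winv s ++ winv r) ((winv V ++ s) ++ winv s ++ winv r).
    rewrite catA; apply: cat_raag_eq => //; exact: (comm_winv CsV).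
  by rewrite -catA catKVw.
exists (commw V r); split=> //.
  move=> c; rewrite /commw !supp_cat !mem_cat !supp_winv.
  have Rr : c \in supp r -> exists2 i, i <= j.+1 & reach i c.
    case/mapP=> y; rewrite mem_filter => /andP [Ry _] ->; by exists j.+1.
  have RV' : c \in supp V -> exists2 i, i <= j.+1 & reach i c.
    by case/RV=> i ij Ri; exists i => //; apply: leqW.
  by case/or4P.
move=> _ N; have -> : r = [::].
  apply: filter_predC_nil.
  by apply/allP => y _; apply: N.
by rewrite /commw /= cats0 catwV.
Qed.

Lemma reach_chain j c : reach j c -> exists g : nat -> TB,
  [/\ g j = c, forall i, i <= j -> g i \in supp (psi (x i)) &
     forall i, i < j -> clash (g i) (g i.+1)].
Proof.
elim: j c => [|j IH] c Rc.
  exists (fun=> c); split=> // i; rewrite leqn0 => /eqP ->; exact: (@reach_supp 0).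
case/andP: Rc => cs /existsP [d /andP [/IH [g [gj gs gc]] dc]].
exists (fun i => if i == j.+1 then c else g i); split; first by rewrite eqxx.
  move=> i; rewrite leq_eqVlt => /orP [/eqP ->|ij]; first by rewrite eqxx.
  by rewrite (ltn_eqF ij) gs.
move=> i; rewrite ltnS leq_eqVlt eqSS => /orP [/eqP ->|ij].
  by rewrite eqxx (ltn_eqF (ltnSn j)) gj.
by rewrite (ltn_eqF ij) (ltn_eqF (ltnW ij : i < j.+1)) gc.
Qed.

End Chain.

(** * Nontriviality of the iterated commutator of a path *)

Section ChainNontrivial.
Local Open Scope ring_scope.
Variables (x : nat -> TL) (pos : TL -> option nat) (n : nat).
Hypothesis pos_x : forall i, (i <= n)%N -> pos (x i) = Some i.
Hypothesis pos_comm : forall u v i j, eL u v -> pos u = Some i -> pos v = Some j ->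
  i.+1 != j /\ j.+1 != i /\ i != j.

(* x_i acts as the elementary transvection F_i += F_{i+1}. *)
Definition transv (u : TL) (b : bool) (F : nat -> int) : nat -> int := fun k =>
  if pos u == Some k then (if b then F k - F k.+1 else F k + F k.+1) else F k.

Lemma transvK u b F : transv u b (transv u (~~ b) F) = F.
Proof.
apply: functional_extensionality => k; rewrite /transv.
case: (pos u =P Some k) => [->|//].
have -> : (Some k == Some k.+1 :> option nat) = false by apply/eqP => -[]; lia.
by case: b => /=; lia.
Qed.

Lemma transvC u v b c F : eL u v ->
  transv u b (transv v c F) = transv v c (transv u b F).
Proof.
move=> /pos_comm uv; apply: functional_extensionality => k; rewrite /transv.
case Eu: (pos u) => [i|]; case Ev: (pos v) => [j|] //.
have [H1 [H2 H3]] := uv _ _ Eu Ev.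
have SE a a' : (Some a == Some a' :> option nat) = (a == a') by [].
rewrite !SE; case: (i =P k) => [ik|_]; case: (j =P k) => [jk|_] //.
- by rewrite ik jk eqxx in H3.
- by rewrite -ik eq_sym (negPf H1).
- by rewrite -jk eq_sym (negPf H2).
Qed.

Local Notation act := (actw transv).

Lemma act_pow i (b : bool) F k : (i <= n)%N ->
  act (wpow [:: (x i, b)] M) F k =
  if k == i then (if b then F i - F i.+1 *+ M else F i + F i.+1 *+ M) else F k.
Proof.
move=> le_in; rewrite actw_wpow.
elim: (M) F k => [|m IH] F k; first by rewrite /=; case: eqP => [->|]; case: b; lia.
rewrite iterSr IH /= /transv pos_x //.
have SE a a' : (Some a == Some a' :> option nat) = (a == a') by [].
rewrite !SE eqxx (ltn_eqF (ltnSn i)) (eq_sym i).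
by case: (k =P i) => // _; clear IH; case: b; rewrite mulrS; lia.
Qed.

(** The commutator of the transvections [F_0 += c F_(j+1)] and [F_(j+1) += M F_(j+2)] is
    [F_0 += c M F_(j+2)]; the coefficient for [j] is thus [M^(j+1)]. *)
Lemma chain_word_act j : (j <= n)%N -> exists2 c : int, c != 0 &
  forall F k, act (hom_ext pw (chain_word x j)) F k = F k + (if k == 0%N then c * F j.+1 else 0).
Proof.
elim: j => [|j IH] jn.
  exists M%:R; first by rewrite pnatr_eq0 -lt0n.
  move=> F k; rewrite /chain_word /= hom_ext_gen act_pow //.
  by case: eqP => [->|]; rewrite ?addr0 // mulr_natl.
have [c c0 Hc] := IH (ltnW jn).
(* Coordinate [i] is left unchanged as [i != 0], so the inverse subtracts the same multiple. *)
have winvE w d i : i != 0%N ->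
    (forall F k, act w F k = F k + (if k == 0%N then d * F i else 0)) ->
    forall F k, act (winv w) F k = F k - (if k == 0%N then d * F i else 0).
  move=> i0 Hw F k; have E k' := congr1 (fun G => G k') (actw_winvK transvK transvC w F).
  move: (E k) (E i); rewrite /= !Hw (negPf i0) addr0 => <- <-.
  by case: eqP; lia.
exists (c * M%:R); first by rewrite mulf_neq0 // pnatr_eq0 -lt0n.
move=> F k; rewrite chain_wordS hom_ext_commw hom_ext_gen /commw.
rewrite !actw_cat Hc.
have -> : winv (wpow (gen (x j.+1)) M) = wpow [:: (x j.+1, true)] M.
  by rewrite winv_wpow.
rewrite !act_pow // !(winvE _ c j.+1) // !act_pow //.
have jj : (j.+2 == j.+1) = false by lia.
have j0 : (j.+1 == 0%N) = false by [].
rewrite ?jj ?j0 !eqxx /=.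
by case: (k =P j.+1) => [->|kj]; case: (k =P 0%N) => [k0|k0] //=; rewrite ?jj ?j0 ?eqxx ?mulr_natr; lia.
Qed.

Lemma chain_word_nontrivial : ~ raag_eq eL (hom_ext pw (chain_word x n)) [::].
Proof.
move=> H; have [c c0 Hc] := chain_word_act (leqnn n).
(* Starting from the indicator of [n.+1], coordinate [0] moves from [0] to [c]. *)
pose F k := (k == n.+1)%:R : int.
have := congr1 (fun G => G 0%N) (actw_raag transvK transvC H F).
by rewrite /= Hc /F /= eqxx mulr1 add0r => /eqP; rewrite (negPf c0).
Qed.
End ChainNontrivial.

(** * Exponents *)

Section Exponents.
Local Open Scope ring_scope.

(** The coordinate at [c] in the abelianization. *)
Definition exponent (T : finType) (c : T) (w : word T) : int :=
  (count_mem (c, false) w)%:Z - (count_mem (c, true) w)%:Z.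

Definition zpow (T : finType) (u : T) (k : int) : word T :=
  match k with
  | Posz n => wpow [:: (u, false)] n
  | Negz n => wpow [:: (u, true)] n.+1
  end.

Lemma supp_zpow (T : finType) (u : T) k : {subset supp (zpow u k) <= [:: u]}.
Proof.
by case: k => k v /supp_wpow1 ->; rewrite inE.
Qed.

Lemma exponent_cat (T : finType) (c : T) w s :
  exponent c (w ++ s) = exponent c w + exponent c s.
Proof. by rewrite /exponent !count_cat; lia. Qed.

Lemma exponent_winv (T : finType) (c : T) w : exponent c (winv w) = - exponent c w.
Proof.
have E b : count_mem (c, b) (winv w) = count_mem (c, ~~ b) w.
  rewrite /winv count_rev count_map; apply: eq_count => -[u a] /=.
  by rewrite !xpair_eqE; case: a b => [] [].
by rewrite /exponent !E /=; lia.
Qed.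

Lemma exponent_wpow (T : finType) (c : T) w n : exponent c (wpow w n) = exponent c w *+ n.
Proof. by elim: n => // n IH; rewrite wpowS exponent_cat IH mulrS. Qed.

Lemma exponent_hom_zpow c u k :
  exponent c (hom_ext psi (zpow u k)) = k * exponent c (psi u).
Proof.
case: k => n /=; rewrite hom_ext_wpow hom_ext_gen exponent_wpow ?exponent_winv.
  by rewrite -mulr_natl natz.
by rewrite NegzE -mulr_natl natz mulrN mulNr.
Qed.

Lemma restr1_trivial c w : exponent c w = 0 -> raag_eq eB (restr (pred1 c) w) [::].
Proof.
have E : raag_eq eB (restr (pred1 c) w) (wpow [:: (c, false)] (count_mem (c, false) w) ++
    wpow [:: (c, true)] (count_mem (c, true) w)).
  elim: w => // [[u b] w] IH.
  have -> : restr (pred1 c) ((u, b) :: w) =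
      if u == c then (u, b) :: restr (pred1 c) w else restr (pred1 c) w by [].
  rewrite /= !xpair_eqE; case: eqP => [->|_] /=; last by rewrite !add0n.
  rewrite IH; case: b; last by rewrite add0n add1n.
  rewrite add0n add1n wpowS.
  rewrite -cat1s !catA; apply: cat_raag_eq => //.
  apply: (@comm_letters _ _ [:: _]) => y z; rewrite inE => /eqP -> zw; right.
  by rewrite (supp_wpow1 (map_f fst zw)).
rewrite /exponent => /eqP; rewrite subr_eq0 => /eqP [En].
rewrite E En; have -> : wpow [:: (c, true)] (count_mem (c, true) w) =
  winv (wpow [:: (c, false)] (count_mem (c, true) w)) by rewrite winv_wpow.
exact: catwV.
Qed.

(** Over a clique the word sorts into its one-letter parts, each of exponent zero. *)
Lemma abelian_trivial w :
  (forall c d, c \in supp w -> d \in supp w -> eB c d \/ c = d) ->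
  (forall c, exponent c w = 0) -> raag_eq eB w [::].
Proof.
move=> wC w0; have := @teq_partition TB eB eB_sym eB_irr TB id (enum TB) w.
move=> /(_ (enum_uniq _)) H; rewrite (teq_raag eB_sym eB_irr (H _ _)).
- elim: (enum TB) => //= c r ->; rewrite cats0.
  exact: (restr1_trivial (w0 c)).
- by move=> u _; rewrite mem_enum.
- by move=> u v us vs /eqP uv; case: (wC _ _ us vs).
Qed.

End Exponents.

Lemma supp_hom_ext (P : pred TB) w :
  (forall u, u \in supp w -> {in supp (psi u), forall c, P c}) ->
  {in supp (hom_ext psi w), forall c, P c}.
Proof.
elim: w => // [[u b] w] IH H c.
rewrite -cat1s hom_ext_cat hom_ext_gen supp_cat mem_cat => /orP [cu|].
  apply: (H u); first by rewrite inE eqxx.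
  by case: b cu {H}; rewrite ?supp_winv.
by apply: IH => v vw; apply: H; rewrite inE vw orbT.
Qed.

(** * Paths with three vertices *)

Section Star.
Local Open Scope ring_scope.
Variables x0 x1 x2 : TL.
Hypotheses (e02 : eL x0 x2) (e01 : ~~ eL x0 x1) (e12 : ~~ eL x1 x2).
Hypotheses (n01 : x0 != x1) (n12 : x1 != x2) (n02 : x0 != x2).

(** [x0] and [x2] act on the rationals by the commuting scalings 2 and 3, [x1] by a translation, all
    other generators trivially. As [x1] commutes with neither [x0] nor [x2] in the group, the
    relations are respected. *)
Definition affine (u : TL) (b : bool) (t : rat) : rat :=
  if u == x0 then (if b then t / 2%:R else t * 2%:R) else
  if u == x2 then (if b then t / 3%:R else t * 3%:R) else
  if u == x1 then (if b then t - 1 else t + 1) else t.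

Lemma affineK u b t : affine u b (affine u (~~ b) t) = t.
Proof.
rewrite /affine; case: (u == x0); first by case: b => /=; lra.
case: (u == x2); first by case: b => /=; lra.
by case: (u == x1) => //; case: b => /=; lra.
Qed.

Lemma affineC u v b c t : eL u v -> affine u b (affine v c t) = affine v c (affine u b t).
Proof.
move=> uv; rewrite /affine.
have e10 : ~~ eL x1 x0 by rewrite eL_sym.
have e21 : ~~ eL x2 x1 by rewrite eL_sym.
case: (u =P x0) => [ux|_].
  case: (v =P x0) => [_|_]; first by case: b c => [] []; lra.
  case: (v =P x2) => [_|_]; first by case: b c => [] []; lra.
  by case: (v =P x1) => [vx|//]; rewrite ux vx (negPf e01) in uv.
case: (u =P x2) => [ux|_].
  case: (v =P x0) => [_|_]; first by case: b c => [] []; lra.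
  case: (v =P x2) => [_|_]; first by case: b c => [] []; lra.
  by case: (v =P x1) => [vx|//]; rewrite ux vx (negPf e21) in uv.
case: (u =P x1) => [ux|_ //].
case: (v =P x0) => [vx|_]; first by rewrite ux vx (negPf e10) in uv.
case: (v =P x2) => [vx|_]; first by rewrite ux vx (negPf e12) in uv.
by case: (v =P x1) => // _; case: b c => [] []; lra.
Qed.

Local Notation act := (actw affine).

(** Multiplicative independence of 2 and 3: once negative exponents are cleared, parity removes the
    power of 2. *)
Lemma pow23 (a b : int) : (2%:R : rat) ^ a * 3%:R ^ b = 1 -> a = 0 /\ b = 0.
Proof.
have nz2 k : (2%:R : rat) ^+ k != 0 by rewrite expf_neq0.
have nz3 k : (3%:R : rat) ^+ k != 0 by rewrite expf_neq0.
have N m k : (2%:R : rat) ^+ m = 3%:R ^+ k -> m = 0%N /\ k = 0%N.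
  rewrite -!natrX => /eqP; rewrite eqr_nat => /eqP E.
  have := congr1 odd E; rewrite !oddX /= orbF orbT => /eqP m0.
  by move: E; rewrite m0; case: k => // k; rewrite expnS; lia.
have P m k : (2%:R : rat) ^+ m * 3%:R ^+ k = 1 -> m = 0%N /\ k = 0%N.
  rewrite -!natrX -natrM => /eqP; rewrite (eqr_nat _ _ 1) => /eqP E.
  have := congr1 odd E; rewrite oddM !oddX /= orbT andbT orbF => /eqP m0.
  by move: E; rewrite m0; case: k => // k; rewrite expnS; lia.
case: a b => [m|m] [k|k]; rewrite ?NegzE -?exprnP -?exprnN ?exprVn.
- by move=> /P [-> ->].
- move=> H; have /N [_] // : (2%:R : rat) ^+ m = 3%:R ^+ k.+1.
  by rewrite -(divfK (nz3 k.+1) (2%:R ^+ m)) H mul1r.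
- move=> H; have /N [] // : (2%:R : rat) ^+ m.+1 = 3%:R ^+ k.
  by have := congr1 ( *%R (2%:R ^+ m.+1)) H; rewrite mulrA divff ?nz2 // mul1r mulr1.
- rewrite -invfM => H; have /P [] // : (2%:R : rat) ^+ m.+1 * 3%:R ^+ k.+1 = 1.
  by rewrite -[LHS]invrK H invr1.
Qed.

Lemma act_zpow u (l : rat) k t : l != 0 ->
  (forall b t, affine u b t = if b then t / l else t * l) ->
  act (hom_ext pw (zpow u k)) t = t * l ^ (k * M%:Z).
Proof.
move=> l0 Hu.
have I n : iter n (fun t => t * l) t = t * l ^+ n.
  by elim: n => [|n /= ->]; rewrite ?expr0 ?mulr1 // exprSr mulrA.
have IV n : iter n (fun t => t / l) t = t / l ^+ n.
  elim: n => [|n /= ->]; rewrite ?expr0 ?divr1 // exprSr invfM; ring.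
case: k => n; rewrite /zpow hom_ext_wpow hom_ext_gen.
  rewrite -wpowM actw_wpow (@eq_iter _ _ (fun t => t * l)) ?I; last by move=> s; rewrite /= Hu.
  by rewrite -PoszM mulnC.
rewrite winv_wpow -wpowM actw_wpow (@eq_iter _ _ (fun t => t / l)) ?IV; last first.
  by move=> s; rewrite /= Hu.
by rewrite NegzE mulNr -PoszM -exprnN mulnC.
Qed.

(** The commutator of the translation by [tau] with the scaling by [l] is the translation by
    [(1 - l) tau]. *)
Lemma foldl_commw_translation us w (tau : rat) : tau != 0 ->
  (forall t, act w t = t + tau) ->
  (forall u, u \in us -> exists l : rat, [/\ l != 0, l != 1 & forall t, act u t = t * l]) ->
  exists2 tau' : rat, tau' != 0 & forall t, act (foldl (@commw TL) w us) t = t + tau'.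
Proof.
elim: us w tau => [|u us IH] w tau tau0 Hw Hus; first by exists tau.
have [|l [l0 l1 Hu]] := Hus u; first by rewrite inE eqxx.
apply: (IH _ ((1 - l) * tau)).
- by rewrite mulf_neq0 // subr_eq0 eq_sym.
- move=> t; rewrite /commw !actw_cat.
  have Vw s : act (winv w) s = s - tau.
    by have := actw_winvK affineK affineC w s; rewrite Hw => {2}<-; ring.
  have Vu s : act (winv u) s = s / l.
    by have := actw_winvK affineK affineC u s; rewrite Hu => {2}<-; field.
  by rewrite Hw Hu Vw Vu; field.
- by move=> v vus; apply: Hus; rewrite inE vus orbT.
Qed.

(* Otherwise each letter y of psi x1 clashes with at most one letter k y of psi x0 and
   psi x2, and letters with different k commute.  Some u_c <> 1 in <x0, x2> has
   exponent 0 at c, so the iterated commutator of x1 with all the u_c is killed on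
   each block k = c; but it is a non-trivial translation under affine. *)
Lemma star_exists : exists y z z',
  [/\ y \in supp (psi x1),
      (z \in supp (psi x0)) || (z \in supp (psi x2)),
      (z' \in supp (psi x0)) || (z' \in supp (psi x2)),
      z != z' & clash z y && clash z' y].
Proof.
apply: NNPP => N.
pose Z : pred TB := fun c => (c \in supp (psi x0)) || (c \in supp (psi x2)).
have uniq_clash y z z' : y \in supp (psi x1) -> Z z -> Z z' -> clash z y -> clash z' y -> z = z'.
  move=> ys Zz Zz' c1 c2; apply/eqP/negPn/negP => nz.
  by apply: N; exists y, z, z'; rewrite c1 c2; split.
have ZC c d : Z c -> Z d -> ~~ clash c d.
  move=> /orP Zc /orP Zd.
  have e20 : eL x2 x0 by rewrite eL_sym.
  have : eB c d \/ c = d.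
    case: Zc => cs; case: Zd => ds; apply: (psi_comm _ cs ds);
    by rewrite ?eqxx ?orbT // ?e02 ?e20.
  by rewrite /clash => -[->|->]; rewrite ?andbF ?eqxx.
have YC c d : c \in supp (psi x1) -> d \in supp (psi x1) -> ~~ clash c d.
  move=> cs ds; have : eB c d \/ c = d by apply: (psi_comm _ cs ds); rewrite eqxx orbT.
  by rewrite /clash => -[->|->]; rewrite ?andbF ?eqxx.
(* [k c] is the letter of [Z] that clashes with [c], and [c] itself by default; as [Z] is a clique,
   [k] is the identity on [Z]. *)
pose k c := if [pick z | Z z && clash z c] is Some z then z else c.
have kZ c : Z c -> k c = c.
  move=> Zc; rewrite /k; case: pickP => // z /andP [Zz cz].
  by have := ZC _ _ Zz Zc; rewrite cz.
have kY y z : y \in supp (psi x1) -> Z z -> clash z y -> k y = z.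
  move=> ys Zz cz; rewrite /k; case: pickP => [z' /andP [Zz' cz']|/(_ z)].
    exact: (uniq_clash y).
  by rewrite Zz cz.
have kE c d : (c \in supp (psi x1)) || Z c -> (d \in supp (psi x1)) || Z d ->
    clash c d -> k c = k d.
  move=> /orP [cs|Zc] /orP [ds|Zd] cd.
  - by have := YC _ _ cs ds; rewrite cd.
  - by rewrite (kZ d) // (kY c d) // clash_sym.
  - by rewrite (kZ c) // (kY d c).
  - by have := ZC _ _ Zc Zd; rewrite cd.
pose e0 c := exponent c (psi x0); pose e2 c := exponent c (psi x2).
(* The exponents [(e2, - e0)] cancel the letter [c]. If both vanish, any pair does so, and [(1, 0)]
   keeps [u c] non-trivial. *)
pose ab c : int * int := if (e0 c == 0) && (e2 c == 0) then (1, 0) else (e2 c, - e0 c).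
pose u c := zpow x0 (ab c).1 ++ zpow x2 (ab c).2.
have suppU c : {in supp (hom_ext psi (u c)), forall d, Z d}.
  apply: supp_hom_ext => v; rewrite supp_cat mem_cat => /orP [] /supp_zpow;
  by rewrite inE => /eqP -> d ds; rewrite /Z ds ?orbT.
pose W := foldl (@commw TL) (gen x1) [seq u c | c <- enum TB].
have suppW : {in supp (hom_ext psi W), forall d, (d \in supp (psi x1)) || Z d}.
  rewrite /W hom_ext_foldl_commw -map_comp.
  have : {in supp (hom_ext psi (gen x1)), forall d, (d \in supp (psi x1)) || Z d}.
    by rewrite hom_ext_gen => d ->.
  elim: (enum TB) (hom_ext psi (gen x1)) => //= c r IH a Ha; apply: IH => d.
  rewrite /commw !supp_cat !mem_cat !supp_winv => /or4P [/Ha|/suppU ->|/Ha|/suppU ->] //;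
  by rewrite orbT.
have W0 : raag_eq eB (hom_ext psi W) [::].
  have := @teq_partition TB eB eB_sym eB_irr TB k (enum TB) (hom_ext psi W).
  move=> /(_ (enum_uniq _)) H; rewrite (teq_raag eB_sym eB_irr (H _ _)).
  - have : {subset enum TB <= enum TB} by [].
    elim: {1 3}(enum TB) => //= c r IH cr; rewrite IH; last first.
      by move=> d dr; apply: cr; rewrite inE dr orbT.
    rewrite cats0 /W hom_ext_foldl_commw restr_foldl_commw.
    apply: foldl_commw_trivial => //.
    exists (restr (fun d => k d == c) (hom_ext psi (u c))).
      by do 3!apply: map_f; rewrite mem_enum.
    (* Since [k] fixes [Z], the block of [u c] at [c] consists of its letters [c], whose exponents
       add up to zero. *)
    have -> : restr (fun d => k d == c) (hom_ext psi (u c)) = restr (pred1 c) (hom_ext psi (u c)).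
      by apply: eq_in_filter => y /(map_f fst) /suppU Zy /=; rewrite kZ.
    apply: restr1_trivial; rewrite /u hom_ext_cat exponent_cat !exponent_hom_zpow.
    rewrite /ab -/(e0 c) -/(e2 c); case: ifP => [/andP [/eqP -> /eqP ->]|_] /=; ring.
  - by move=> d _; rewrite mem_enum.
  - move=> c d /suppW cs /suppW ds cd; have [//|E] : eB c d \/ c = d.
      by apply: clashPn; apply: contra cd => /(kE _ _ cs ds) ->.
    by rewrite E eqxx in cd.
have H := psi_inj W0; rewrite /W hom_ext_foldl_commw -map_comp in H.
have actx0 b t : affine x0 b t = if b then t / 2%:R else t * 2%:R by rewrite /affine eqxx.
have actx2 b t : affine x2 b t = if b then t / 3%:R else t * 3%:R.
  by rewrite /affine eqxx eq_sym (negPf n02).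
have [|||tau tau0 Htau] := @foldl_commw_translation
   [seq hom_ext pw (u c) | c <- enum TB] (hom_ext pw (gen x1)) M%:R.
- by rewrite pnatr_eq0 -lt0n.
- move=> t; rewrite hom_ext_gen actw_wpow.
  elim: (M) => [|m /= ->]; rewrite ?addr0 //= /affine eq_sym (negPf n01) (negPf n12) eqxx.
  by rewrite -addrA natr1.
(* The scaling factor differs from 1 because [ab c] is never [(0, 0)]. *)
- move=> _ /mapP [c _ ->]; exists (2%:R ^ ((ab c).1 * M%:Z) * 3%:R ^ ((ab c).2 * M%:Z)).
  split.
  + by rewrite mulf_neq0 // expfz_neq0.
  + apply/eqP => /pow23 []; move/eqP; rewrite mulf_eq0 => + /eqP; rewrite mulf_eq0.
    have -> : (M%:Z == 0) = false by lia.
    rewrite !orbF /ab; case: ifP => //=; lia.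
  + move=> t; rewrite hom_ext_cat actw_cat (act_zpow _ _ _ actx0) // (act_zpow _ _ _ actx2) //.
    ring.
have := actw_raag affineK affineC H 0; rewrite Htau /= => /eqP.
by rewrite add0r (negPf tau0).
Qed.

End Star.

(** * Cliques *)

Section Rank.
Local Open Scope ring_scope.
Variable I : {set TL}.
Hypothesis IC : {in I &, forall i j, i != j -> eL i j}.

Definition shift (i0 u : TL) (b : bool) (t : int) : int :=
  if u == i0 then (if b then t - 1 else t + 1) else t.

Lemma shiftK i0 u b t : shift i0 u b (shift i0 u (~~ b) t) = t.
Proof. by rewrite /shift; case: (u == i0) => //; case: b => /=; lia. Qed.

Lemma shiftC i0 u v b c t : eL u v ->
  shift i0 u b (shift i0 v c t) = shift i0 v c (shift i0 u b t).
Proof. by move=> _; rewrite /shift; case: (u == i0); case: (v == i0) => //; case: b c => [] []; lia. Qed.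

(** With fewer symbols than vertices, the exponent matrix has a non-zero left kernel vector. An
    integral multiple [n] gives a product [W] of powers [x_i^(n i)] whose image has exponent zero at
    every symbol, so it is trivial over a clique; yet [shift] shows that the same product of [M]-th
    powers is not. *)
Lemma rank_clique : (#|I| <= #|[set c | [exists i in I, c \in supp (psi i)]]|)%N.
Proof.
set K := [set c | _]; rewrite leqNgt; apply/negP => lt_KI.
pose A : 'M[rat]_(#|I|, #|K|) := \matrix_(i, c) (exponent (enum_val c) (psi (enum_val i)))%:~R.
have kA : kermx A != 0.
  by rewrite -mxrank_eq0 mxrank_ker -lt0n subn_gt0 (leq_ltn_trans (rank_leq_col A)).
have [r0 v0] : exists r, row r (kermx A) != 0.
  have [r [c rc]] : exists r c, kermx A r c != 0.
    apply: NNPP => N; case/negP: kA; apply/eqP/matrixP => r c; rewrite [RHS]mxE.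
    by apply/eqP/negPn/negP => rc; apply: N; exists r, c.
  by exists r; apply: contraNneq rc => /rowP /(_ c); rewrite [LHS]mxE [RHS]mxE => ->.
pose v := row r0 (kermx A).
have vA : v *m A = 0 by rewrite -row_mul mulmx_ker row0.
(* Clearing denominators: [n i] is [v 0 i] times the product [D] of all denominators. *)
pose n i : int := numq (v 0 i) * \prod_(j | j != i) denq (v 0 j).
pose D : int := \prod_j denq (v 0 j).
have nE i : (n i)%:~R = v 0 i * D%:~R :> rat.
  rewrite /n /D [in RHS](bigD1 i) //= !intrM mulrA; congr (_ * _).
  by rewrite -{2}[v 0 i]divq_num_den divfK // intr_eq0 denq_neq0.
have D0 : D != 0 by apply/prodf_neq0 => j _; apply: denq_neq0.
have [i0 ni0] : exists i, n i != 0.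
  apply: NNPP => N; case/negP: v0; apply/eqP/rowP => i.
  rewrite -/v [RHS]mxE; apply: (@mulIf _ (D%:~R)); first by rewrite intr_eq0.
  rewrite -nE mul0r; apply/eqP; rewrite intr_eq0.
  by apply/negPn/negP => ni; apply: N; exists i.
pose W : word TL := flatten [seq zpow (enum_val i) (n i) | i <- enum 'I_#|I|].
have suppW : {subset supp W <= I}.
  move=> u /mapP [y /flattenP [_ /mapP [i _ ->] yi] ->].
  by have := supp_zpow (map_f fst yi); rewrite inE => /eqP ->; apply: enum_valP.
have suppK : {in supp (hom_ext psi W), forall c, c \in K}.
  apply: supp_hom_ext => u /suppW uI c cs; rewrite inE.
  by apply/existsP; exists u; rewrite uI.
have expW c : exponent c (hom_ext psi W) = \sum_i n i * exponent c (psi (enum_val i)).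
  rewrite /W -big_enum; elim: (enum _) => [|i r IH]; first by rewrite big_nil.
  by rewrite /= hom_ext_cat exponent_cat IH big_cons exponent_hom_zpow.
have W0 : raag_eq eB (hom_ext psi W) [::].
  apply: abelian_trivial => [c d /suppK|c].
    rewrite inE => /existsP [i /andP [iI ci]] /suppK.
    rewrite inE => /existsP [j /andP [jI dj]]; apply: (@psi_comm i j) => //.
    by case: eqP => [->|/eqP ij]; rewrite ?orbT // orbF; apply: IC.
  case: (boolP (c \in K)) => cK; last first.
    have N b : count_mem (c, b) (hom_ext psi W) = 0%N.
      apply/eqP; rewrite -leqn0 leqNgt -has_count; apply/hasP => -[y yW /eqP E].
      by case/negP: cK; apply: suppK; apply/mapP; exists y => //; rewrite E.
    by rewrite /exponent !N.
  apply/eqP; rewrite -(intr_eq0 rat) expW rmorph_sum /=.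
  have /matrixP /(_ 0 (enum_rank_in cK c)) := vA.
  rewrite !mxE => vAc.
  rewrite (eq_bigr (fun i => D%:~R * (v 0 i * A i (enum_rank_in cK c)))).
    by rewrite -mulr_sumr vAc mulr0.
  move=> i _; rewrite intrM nE [A _ _]mxE enum_rankK_in //; ring.
have H := psi_inj W0.
have aW t : actw (shift (enum_val i0)) (hom_ext pw W) t = t + n i0 * M%:Z.
  have I1 m s : iter m (fun t => t + 1 : int) s = s + m%:Z.
    by elim: m => [|m IH]; [rewrite addr0 | rewrite iterS IH; lia].
  have I2 m s : iter m (fun t => t - 1 : int) s = s - m%:Z.
    by elim: m => [|m IH]; [rewrite subr0 | rewrite iterS IH; lia].
  have az i s : actw (shift (enum_val i0)) (hom_ext pw (zpow (enum_val i) (n i))) s =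
      if i == i0 then s + n i0 * M%:Z else s.
    case: (eqVneq i i0) => [->|ii].
      case: (n i0) => m; rewrite /zpow hom_ext_wpow hom_ext_gen ?winv_wpow -wpowM actw_wpow.
        rewrite (@eq_iter _ _ (fun t => t + 1)) ?I1 /=; first lia.
        by move=> x; rewrite /= /shift eqxx.
      rewrite (@eq_iter _ _ (fun t => t - 1)) ?I2 /=; first lia.
      by move=> x; rewrite /= /shift eqxx.
    have idE m b x : iter m (actw (shift (enum_val i0)) [:: (enum_val i, b)]) x = x.
      by elim: m => //= m ->; rewrite /shift (inj_eq enum_val_inj) (negPf ii).
    by case: (n i) => m; rewrite /zpow hom_ext_wpow hom_ext_gen ?winv_wpow -wpowM actw_wpow idE.
  rewrite /W.
  have G (r : seq 'I_#|I|) s : uniq r ->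
      actw (shift (enum_val i0)) (hom_ext pw (flatten [seq zpow (enum_val i) (n i) | i <- r])) s =
      if i0 \in r then s + n i0 * M%:Z else s.
    elim: r => //= i r IH /andP [ir ur]; rewrite hom_ext_cat actw_cat IH // az inE.
    rewrite (eq_sym i0); case: eqP => //= <-; by rewrite (negPf ir).
  by rewrite G ?enum_uniq // mem_enum.
have := actw_raag (shiftK (enum_val i0)) (@shiftC (enum_val i0)) H 0.
rewrite aW /= add0r => /eqP; rewrite mulf_eq0 (negPf ni0) /=; lia.
Qed.

End Rank.

(** * Embedding the complement of a linear forest *)

Section Forest.
Variables (ns : seq nat) (f : TL -> nat * nat).
Hypotheses (f_inj : injective f)
  (f_dom : forall x, (f x).1 < size ns /\ (f x).2 < nth 0 ns (f x).1)
  (f_surj : forall i j, i < size ns -> j < nth 0 ns i -> exists x, f x = (i, j))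
  (eLE : forall x y, x != y -> eL x y = ~~ path_forest_adj (f x) (f y)).

(** [g a] may come from any vertex of component [j]: in a three-vertex path both outer symbols can
    come from the same end. *)
Definition component_embedding j (g : nat -> TB) :=
  [/\ forall a, a < nth 0 ns j -> exists2 x, (f x).1 = j & g a \in supp (psi x),
      forall a, a.+1 < nth 0 ns j -> clash (g a) (g a.+1) &
      forall a b, a.+1 < b -> b < nth 0 ns j -> eB (g a) (g b)].

Lemma clashF c d : eB c d \/ c = d -> clash c d = false.
Proof. by rewrite /clash => -[->|->]; rewrite ?andbF ?eqxx. Qed.

(** A chain from the non-trivial iterated commutator has non-consecutive symbols that commute or
    coincide. Coincidence is excluded by a further neighbour on the path, which is missing only for
    three vertices; there [star_exists] provides two distinct outer symbols. *)
Lemma component_embedding_exists j : j < size ns -> 1 < nth 0 ns j ->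
  exists g, component_embedding j g.
Proof.
move=> js; rewrite /component_embedding; set N := nth 0 ns j => N1.
have [x00 _] := f_surj js (ltnW N1).
(* The default [x00] is taken only at positions outside the path. *)
pose x a := odflt x00 [pick y | f y == (j, a)].
have fx a : a < N -> f (x a) = (j, a).
  move=> aN; rewrite /x; case: pickP => [y /eqP //|].
  by have [y fy] := f_surj js aN; move=> /(_ y); rewrite fy eqxx.
have nx a b : a < N -> b < N -> a != b -> x a != x b.
  by move=> aN bN; apply: contraNneq => /(congr1 f); rewrite !fx // => -[->].
have eLx a b : a < N -> b < N -> a != b -> eL (x a) (x b) = (a.+1 != b) && (b.+1 != a).
  move=> aN bN ab; rewrite eLE ?nx // !fx // /path_forest_adj /= eqxx /=.
  by rewrite negb_or.
have far a b : a.+1 < b -> b < N -> eL (x a) (x b).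
  by move=> ab bN; rewrite eLx; lia.
case: (eqVneq N 3) => N3.
  have [|||||| y [z [z' [ys zs zs' nz /andP [cz cz']]]]] := @star_exists (x 0) (x 1) (x 2);
    try by rewrite ?eLx ?nx; lia.
  have f1 a : a < N -> (f (x a)).1 = j by move=> /fx ->.
  exists (fun a => if a == 0 then z else if a == 1 then y else z'); split.
  - move=> a aN; case: (eqVneq a 0) => [_|a0].
      by case/orP: zs => zs; [exists (x 0) | exists (x 2)] => //; apply: f1; lia.
    case: (eqVneq a 1) => [_|a1]; first by exists (x 1) => //; apply: f1; lia.
    by case/orP: zs' => zs'; [exists (x 0) | exists (x 2)] => //; apply: f1; lia.
  - move=> a; rewrite N3; case: a => [|[|a]] //= _; by rewrite clash_sym.
  - move=> a b ab; rewrite N3 => b3.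
    have -> : a = 0 by lia. have -> /= : b = 2 by lia.
    suff [//|E] : eB z z' \/ z = z' by rewrite E eqxx in nz.
    have e02 : eL (x 0) (x 2) by apply: far; lia.
    have e20 : eL (x 2) (x 0) by rewrite eL_sym.
    by case/orP: zs => zs; case/orP: zs' => zs'; apply: (psi_comm _ zs zs');
       rewrite ?eqxx ?orbT // ?e02 ?e20.
have [n NE] : exists n, N = n.+2 by exists (N - 2); lia.
have xC i k : i.+1 < k -> k <= n.+1 -> eL (x i) (x k) by move=> ik kn; apply: far; lia.
have [V [HV _ V0]] := chain_word_reach xC (leqnn _).
pose pos u := if (f u).1 == j then Some (f u).2 else None.
have NT : ~ raag_eq eL (hom_ext pw (chain_word x n.+1)) [::].
  apply: (@chain_word_nontrivial x pos n.+1).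
  - by move=> i ni; rewrite /pos fx ?eqxx //; lia.
  - move=> u v i k uv; rewrite /pos; case: eqP => // u1 [u2]; case: eqP => // v1 [v2].
    have nuv : u != v by apply: contraTneq uv => ->; rewrite eL_irr.
    have fE w : f w = ((f w).1, (f w).2) by case: (f w).
    have nik : i != k.
      by apply: contra nuv => /eqP ik; apply/eqP/f_inj; rewrite (fE u) (fE v) u1 v1 u2 v2 ik.
    move: uv; rewrite eLE // /path_forest_adj u1 v1 eqxx /= negb_or u2 v2 => /andP [] //.
have [c Rc] : exists c, reach x n.+1 c.
  apply: NNPP => Nc; apply: NT; apply: psi_inj; rewrite HV; apply: V0 => // c.
  by apply/negP => Rc; apply: Nc; exists c.
have [g [_ gs gc]] := reach_chain Rc.
have D a b : a < N -> b < N -> a.+1 < b \/ b.+1 < a -> eB (g a) (g b) \/ g a = g b.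
  move=> aN bN ab; apply: (@psi_comm (x a) (x b)); [|apply: gs; lia|apply: gs; lia].
  by rewrite eLx //; lia.
exists g; split.
- by move=> a aN; exists (x a); [rewrite fx | apply: gs; lia].
- by move=> a aN; apply: gc; lia.
- move=> a b ab bN; have aN : a < N by lia.
  have [//|E] := D a b aN bN (or_introl ab); exfalso.
  case: (ltnP a.+2 b) => ab3.
    have := gc a; rewrite E clash_sym clashF; first by move=> H; have := H (ltac:(lia)).
    by apply: D; lia.
  have bE : b = a.+2 by lia.
  case: a => [|a] in ab aN E ab3 bE *.
    have : clash (g b) (g b.+1) by apply: gc; lia.
    by rewrite -E clashF //; apply: D; lia.
  have : clash (g a) (g a.+1) by apply: gc; lia.
  by rewrite E clashF //; apply: D; lia.
Qed.

(** The isolated vertices [I] of the forest are injected into the symbols [K] of their images, as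
    [rank_clique] allows; every longer path uses its own chain. *)
Lemma clique_embedding : exists h : TL -> TB, forall x y, x != y ->
  h x != h y /\ eB (h x) (h y) = eL x y.
Proof.
pose I := [set x | nth 0 ns (f x).1 == 1].
have fE w : f w = ((f w).1, (f w).2) by case: (f w).
have eLfst x y : (f x).1 != (f y).1 -> eL x y.
  move=> xy; rewrite eLE; first by rewrite /path_forest_adj (negPf xy).
  by apply: contraNneq xy => ->.
have IC : {in I &, forall x y, x != y -> eL x y}.
  move=> x y; rewrite !inE => /eqP xI /eqP yI xy; apply: eLfst.
  apply: contraNneq xy => xy; apply/eqP/f_inj; rewrite (fE x) (fE y) xy.
  have [_] := f_dom x; have [_] := f_dom y; rewrite xI yI !ltnS !leqn0.
  by move=> /eqP -> /eqP ->.
pose K := [set c | [exists x in I, c \in supp (psi x)]].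
have IK : #|I| <= #|K| := rank_clique IC.
have notI x : x \notin I -> 1 < nth 0 ns (f x).1.
  by rewrite inE; have [_] := f_dom x; case: (nth 0 ns (f x).1) => [|[|]].
(* A default symbol [c0] exists unless there is no vertex to embed: any vertex yields a symbol, by
   rank or from its component. *)
have [N0 | [c0 _]] : (forall x : TL, exists c : TB, False) \/ exists c : TB, True.
- case: (pickP (fun _ : TL => true)) => [x _|N]; last by left=> x; have := N x.
  right; case: (boolP (x \in I)) => xI; last first.
    have [g _] := component_embedding_exists (proj1 (f_dom x)) (notI _ xI).
    by exists (g 0).
  have : 0 < #|K| by apply: leq_trans IK; rewrite card_gt0; apply/set0Pn; exists x.
  by rewrite card_gt0 => /set0Pn [c _]; exists c.
- by have [h N] := fin_all_exists N0; exists h => x; have := N x.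
have /fin_all_exists [G HG] : forall j : 'I_(size ns), exists g : nat -> TB,
    1 < nth 0 ns j -> component_embedding j g.
  move=> j; case: (ltnP 1 (nth 0 ns j)) => nj; last by exists (fun=> c0).
  by have [g Hg] := component_embedding_exists (ltn_ord j) nj; exists g.
pose h x := if x \in I then nth c0 (enum K) (index x (enum I))
  else G (Ordinal (proj1 (f_dom x))) (f x).2.
have idxK x : x \in I -> index x (enum I) < size (enum K).
  by move=> xI; rewrite -cardE; apply: leq_trans IK; rewrite cardE index_mem mem_enum.
have hI x : x \in I -> exists2 x', x' \in I & h x \in supp (psi x').
  move=> xI; have : h x \in K by rewrite /h xI -mem_enum mem_nth // idxK.
  by rewrite inE => /existsP [x' /andP [x'I xs]]; exists x'.
have home x : exists2 x', h x \in supp (psi x') &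
    forall y, y \notin I -> (x \in I) || ((f x).1 != (f y).1) ->
    forall y', (f y').1 = (f y).1 -> eL x' y'.
  case: (boolP (x \in I)) => xI.
    have [x' x'I hx] := hI x xI; exists x' => // y yI _ y' yy'; apply: eLfst.
    rewrite yy'; apply: contraNneq yI => E; move: x'I; rewrite !inE E //.
  have [Hg _ _] := HG (Ordinal (proj1 (f_dom x))) (notI x xI).
  have [x' /= xx' hx] := Hg _ (proj2 (f_dom x)).
  exists x'; first by rewrite /h (negPf xI).
  by move=> y _ /= xy y' yy'; apply: eLfst; rewrite xx' yy'.
have neighbour y : y \notin I -> exists2 w, clash w (h y) &
    exists2 y', (f y').1 = (f y).1 & w \in supp (psi y').
  move=> yI; have [Hg Hc _] := HG (Ordinal (proj1 (f_dom y))) (notI y yI).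
  have ny := notI y yI; have [_ dy] := f_dom y; rewrite /h (negPf yI) /=.
  move: (G _) Hg Hc => g /= Hg Hc; case: (f y).2 dy => [|a] dy.
    exists (g 1); first by rewrite clash_sym; apply: Hc.
    by have [y' ? ?] := Hg 1 ny; exists y'.
  exists (g a); first exact: Hc.
  by have [y' ? ?] := Hg a (ltnW dy); exists y'.
(* [h x] comes from a vertex joined to the whole component of [y], so it clashes with neither [h y]
   nor the neighbour [w] of [h y]. As [w] clashes with [h y], the symbols [h x] and [h y] differ. *)
have main x y : y \notin I -> (x \in I) || ((f x).1 != (f y).1) ->
    [/\ h x != h y, eB (h x) (h y) & eL x y].
  move=> yI xy; have [x' hx Hx'] := home x; have {}Hx' := Hx' y yI xy.
  have [w cw [y' yy' ws]] := neighbour y yI.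
  have [Hg _ _] := HG (Ordinal (proj1 (f_dom y))) (notI y yI).
  have [y2 /= yy2 hy] := Hg _ (proj2 (f_dom y)).
  have E1 : eB (h x) (h y) \/ h x = h y.
    apply: (@psi_comm x' y2) => //; first by rewrite Hx'.
    by rewrite /h (negPf yI).
  have E2 : eB (h x) w \/ h x = w by apply: (@psi_comm x' y') => //; rewrite Hx'.
  have nE : h x != h y.
    by apply/eqP => E; move: cw; rewrite clash_sym -E clashF.
  split=> //; first by case: E1 => // E; rewrite E eqxx in nE.
  apply: eLfst; case/orP: xy => // xI; apply: contraNneq yI => E.
  by move: xI; rewrite !inE E.
exists h => x y xy.
case: (boolP (x \in I)) (boolP (y \in I)) => [xI|xI] [yI|yI].
- have nE : h x != h y.
    rewrite /h xI yI nth_uniq ?enum_uniq ?idxK //.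
    apply: contra xy => /eqP E; rewrite -(nth_index x (s := enum I) (x := x)) ?mem_enum //.
    by rewrite E nth_index ?mem_enum.
  split=> //; rewrite IC //.
  have [x' x'I hx] := hI x xI; have [y' y'I hy] := hI y yI.
  have [//|E] : eB (h x) (h y) \/ h x = h y.
    apply: (@psi_comm x' y') => //.
    by case: eqP => [|/eqP E]; rewrite ?orbT // IC.
  by rewrite E eqxx in nE.
- by have [//||-> -> ->] := main x y; rewrite ?xI.
- have [//||nE E1 E2] := main y x; first by rewrite yI.
  by rewrite eq_sym nE eB_sym E1 eL_sym E2.
- case: (eqVneq (f x).1 (f y).1) => [E|nE]; last first.
    by have [//||-> -> ->] := main x y; rewrite ?nE ?orbT.
  have hE z (zI : z \notin I) (zE : (f z).1 = (f x).1) :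
      h z = G (Ordinal (proj1 (f_dom x))) (f z).2.
    by rewrite /h (negPf zI); congr (G _ _); apply: val_inj.
  rewrite (hE x) // (hE y) //.
  have [_ Hc Hf] := HG (Ordinal (proj1 (f_dom x))) (notI x xI).
  move: (G _) Hc Hf => g /= Hc Hf.
  have [_ dx] := f_dom x; have [_ dy] := f_dom y; rewrite -E in dy.
  rewrite eLE // /path_forest_adj E eqxx /=.
  have n2 : (f x).2 != (f y).2.
    by apply: contra xy => /eqP E2; apply/eqP/f_inj; rewrite (fE x) (fE y) E E2.
  move: (f x).2 (f y).2 dx dy n2 => a b an bn ab.
  have R a' b' : a' < b' -> b' < nth 0 ns (f x).1 ->
      g a' != g b' /\ eB (g a') (g b') = (a'.+1 != b').
    move=> ab' bn'; case: (a'.+1 =P b') => [E2|/eqP E2].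
      by have := Hc a'; rewrite E2 => /(_ bn') /andP [-> /negPf].
    have H : eB (g a') (g b') by apply: Hf => //; lia.
    by rewrite H; split=> //; apply: contraTneq H => ->; rewrite eB_irr.
  case: (ltngtP a b) ab => // ab _.
    have [-> ->] := R a b ab bn; split=> //; lia.
  by have [nE RE] := R b a ab an; rewrite eq_sym nE eB_sym RE; split=> //; lia.
Qed.

End Forest.

End Reach.

(** * From pure elements to vertices of the extension graph *)

Section InducedPath.
Variables (X : Type) (nb : rel X) (eqv : X -> X -> Prop) (n : nat) (S : nat -> X -> Prop).
Hypotheses (nb_sym : symmetric nb)
  (nb_eqv : forall x y z, eqv x y -> nb x z = nb y z)
  (n_gt0 : 0 < n)
  (S_ex : exists x, S 0 x)
  (S_conn : forall a (Q : X -> Prop), a < n -> (exists2 x, S a x & Q x) ->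
     (forall x y, S a x -> S a y -> nb x y -> Q x -> Q y) -> forall y, S a y -> Q y)
  (S_link : forall a, a.+1 < n -> exists x y, [/\ S a x, S a.+1 y & nb x y])
  (S_far : forall a b x y, a.+1 < b -> b < n -> S a x -> S b y -> ~~ nb x y /\ ~ eqv x y).

(* A walk carries the index of a set containing each of its vertices. *)
Definition walk m (v : nat -> X) (l : nat -> nat) :=
  [/\ forall k, k <= m -> l k < n /\ S (l k) (v k),
      forall k, k < m -> nb (v k) (v k.+1) & l 0 = 0].

Lemma walk_step m v l b y : walk m v l -> b < n -> S b y -> nb (v m) y ->
  exists m' v' l', [/\ walk m' v' l', l' m' = b & v' m' = y].
Proof.
move=> [W1 W2 W3] bn Sy vy.
exists m.+1, (fun k => if k == m.+1 then y else v k), (fun k => if k == m.+1 then b else l k).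
rewrite eqxx; split=> //; split=> //.
- move=> k; rewrite leq_eqVlt => /orP [/eqP ->|km]; first by rewrite eqxx.
  by rewrite (ltn_eqF km); apply: W1.
- move=> k; rewrite ltnS leq_eqVlt => /orP [/eqP ->|km].
    by rewrite eqxx (ltn_eqF (ltnSn m)).
  by rewrite eqSS (ltn_eqF km) (ltn_eqF (ltnW km : k < m.+1)); apply: W2.
Qed.

Lemma walk_exists a y : a < n -> S a y ->
  exists m v l, [/\ walk m v l, l m = a & v m = y].
Proof.
pose Q b x := exists m v l, [/\ walk m v l, l m = b & v m = x].
have step b c x z : Q b x -> c < n -> S c z -> nb x z -> Q c z.
  move=> [m [v [l [W lm vm]]]] cn Sz xz; apply: (walk_step W) => //.
  by rewrite vm.
elim: a y => [|a IH] y an; apply: (@S_conn _ (Q _) an).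
- case: S_ex => x Sx; exists x => //; exists 0, (fun=> x), (fun=> 0).
  by split=> //; split=> // k; rewrite leqn0 => /eqP ->.
- by move=> x z Sx Sz xz Qx; apply: step Qx _ _ xz.
- have [x [z [Sx Sz xz]]] := S_link an; exists z => //.
  by apply: (step a _ x) => //; apply: IH => //; apply: ltnW.
- by move=> x z Sx Sz xz Qx; apply: step Qx _ _ xz.
Qed.

Lemma walk_shortcut m v l a b : walk m v l -> a.+1 < b -> b <= m -> nb (v a) (v b) ->
  exists m' v' l', [/\ walk m' v' l', l' m' = l m & m' < m].
Proof.
(* [s] skips the indices strictly between [a] and [b], so that [s a.+1 = b]. *)
move=> [W1 W2 W3] ab bm vab; pose s k := if k <= a then k else k + (b - a.+1).
have sE k : s k = if k <= a then k else k + (b - a.+1) by [].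
exists (m - (b - a.+1)), (v \o s), (l \o s); split; last by lia.
  split=> [k km|k km|] /=; rewrite ?sE.
  - by apply: W1; case: ifP; lia.
  - case: (ltngtP k a) => ka.
    + by apply: W2; lia.
    + by rewrite addSn; apply: W2; lia.
    + by rewrite ka; have -> // : a.+1 + (b - a.+1) = b by lia.
  - by rewrite leq0n.
rewrite /= sE; have -> : (m - (b - a.+1) <= a) = false by lia.
congr l; lia.
Qed.

(** A shortest walk from the first set to the last has no chord. Its labels rise by at most one per
    step, so it has at least [n] vertices, and the first [n] are taken. Equivalent vertices at
    distance at least two would give a chord through a neighbour of one of them, except for the two
    ends of the walk, which lie in far sets. *)
Lemma induced_path : exists v : nat -> X,
  [/\ forall a, a < n -> exists2 i, i < n & S i (v a),
      forall a, a.+1 < n -> nb (v a) (v a.+1) &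
      forall a b, a.+1 < b -> b < n -> ~~ nb (v a) (v b) /\ ~ eqv (v a) (v b)].
Proof.
pose P m := exists v l, walk m v l /\ l m = n.-1.
have [m [[v [l [W lm]]] Wmin]] : exists m, P m /\ forall k, k < m -> ~ P k.
  have [m0 Pm0] : exists m, P m.
    have [y Sy] : exists y, S n.-1 y.
      case: (n) S_link n_gt0 => // -[|n'] // link _.
      by have [x [y [_ Sy _]]] := link n' (ltnSn _); exists y.
    have [|m [v [l [W lm _]]]] := @walk_exists n.-1 y _ Sy; first by rewrite prednK.
    by exists m, v, l.
  apply: NNPP => N; elim/ltn_ind: m0 Pm0 => m IH Pm; apply: N; exists m; by split.
have [W1 W2 l0] := W.
have short a b : a.+1 < b -> b <= m -> ~~ nb (v a) (v b).
  move=> ab bm; apply/negP => /(walk_shortcut W ab bm) [m' [v' [l' [W' lm' mm']]]].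
  by apply: (Wmin m' mm'); exists v', l'; rewrite lm'.
have lk k : k <= m -> l k <= k.
  elim: k => [|k IH] km; first by rewrite l0.
  have [ln Sk] := W1 k (ltnW km); have [ln' Sk'] := W1 _ km.
  rewrite leqNgt; apply/negP => L.
  have L2 : (l k).+1 < l k.+1 by have := IH (ltnW km); lia.
  by have [] := S_far L2 ln' Sk Sk'; rewrite W2.
have nm : n.-1 <= m by rewrite -lm lk.
exists v; split.
- by move=> a an; exists (l a); have [|? ?] := W1 a; lia || by [].
- by move=> a an; apply: W2; lia.
- move=> a b ab bn; have bm : b <= m by lia.
  split; first exact: short.
  move=> E; have [bm'|bm'] := ltnP b m.
    have : nb (v a) (v b.+1) by rewrite (nb_eqv _ E); apply: W2.
    by apply/negP; apply: short => //; apply: leqW.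
  have bE : b = m by lia.
  case: a => [|a] in ab E *.
    have [_ S0] := W1 0 (leq0n _); have [_ Sm] := W1 m (leqnn _).
    rewrite l0 in S0; rewrite lm in Sm.
    have [||_ []] := S_far _ _ S0 Sm; try lia.
    by rewrite -bE.
  have : nb (v a) (v b) by rewrite nb_sym -(nb_eqv _ E) nb_sym; apply: W2; lia.
  by apply/negP; apply: short => //; lia.
Qed.

End InducedPath.

Section Generators.
Variables (T : finType) (e : rel T).
Hypotheses (e_sym : symmetric e) (e_irr : irreflexive e).

Definition commb (w s : word T) := raag_eqb e (w ++ s) (s ++ w).

Lemma commP w s : reflect (comm e w s) (commb w s).
Proof. exact: raag_eqP. Qed.

(** Positive words are reduced, so both products agree as traces, and the projection to a
    non-commuting pair shows their order. *)
Lemma comm_gen u v : comm e (gen u) (gen v) -> e u v \/ u = v.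
Proof.
have R a b : reduced e (gen a ++ gen b).
  apply/forallP => x; rewrite /star /=; case: (~~ e x a); case: (~~ e x b) => //=.
  by rewrite /nocancel /= !andbF.
move/(reduced_teq e_sym e_irr (R u v) (R v u)) => H.
case: (boolP (e u v)) => uv; [by left|right].
by have := H _ _ uv; rewrite /proj /= !eqxx !orbT /= => -[].
Qed.

Lemma comm_conj_letters g t b :
  (forall u, u \in supp t -> comm e (cnj g (gen u)) b) -> comm e (cnj g t) b.
Proof.
move=> H; rewrite -(conjVK e g b) (comm_conj e_sym).
have {}H u : u \in supp t -> comm e (gen u) (cnj (winv g) b).
  by move=> ut; rewrite -(comm_conj e_sym g) conjVK; apply: H.
elim: t H => [|[u a] t IH] H; first by apply: comm_sym; apply: comm_nil.
rewrite -cat1s; apply: comm_sym; apply: comm_cat; apply: comm_sym.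
  have Hu : comm e (gen u) (cnj (winv g) b) by apply: H; rewrite inE eqxx.
  case: a {H} => //; apply: comm_sym; apply: (@comm_winv _ e _ (gen u)).
  exact: comm_sym.
by apply: IH => v vt; apply: H; rewrite inE vt orbT.
Qed.

End Generators.

(** * Embedding into the extension graph *)

Section Transfer.
Variables (TL TG : finType) (eL : rel TL) (eG : rel TG).
Hypotheses (eG_sym : symmetric eG) (eG_irr : irreflexive eG).
Variable p : TL -> word TG * word TG.
Hypotheses (p_pure : forall x, pure eG (p x).2)
  (p_far : forall x y, eL x y -> far eG (p x).1 (p x).2 (p y).1 (p y).2)
  (p_clash : forall x y, x != y -> ~~ eL x y -> ~ comm eG (cval (p x)) (cval (p y))).

(** [V x] is the set of extension-graph vertices conjugated from the letters of [p x]. On each path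
    of the forest these sets are connected, consecutive ones are linked and the others are far, so
    [induced_path] applies; sets from different paths are far. *)
Lemma transfer : linear_forest (compl_rel eL) -> exists iota, full_embedding_ext eL eG iota.
Proof.
case=> ns [f [ns_gt0 [f_inj [f_dom [f_surj fE]]]]].
have eLE x y : x != y -> eL x y = ~~ path_forest_adj (f x) (f y).
  by move=> xy; rewrite -fE /compl_rel xy negbK.
have eLfst x y : (f x).1 != (f y).1 -> eL x y.
  move=> xy; rewrite eLE; first by rewrite /path_forest_adj (negPf xy).
  by apply: contraNneq xy => ->.
have cP := commP eG_sym eG_irr.
pose V x w := exists2 u, u \in supp (p x).2 & w = cnj (p x).1 (gen u).
pose nb w s := ~~ commb eG w s.
have nb_sym : symmetric nb.
  by move=> w s; rewrite /nb; congr negb; apply/cP/cP; apply: comm_sym.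
have V_far x y w s : eL x y -> V x w -> V y s -> ~~ nb w s /\ ~ raag_eq eG w s.
  move=> xy [u ux ->] [v vy ->]; have [C N] := p_far xy ux vy.
  by rewrite negbK; split=> //; apply/cP.
have V_ex x : exists w, V x w.
  have [_ + _] := p_pure x; case E: (p x).2 => [|y r] // _.
  by exists (cnj (p x).1 (gen y.1)), y.1; rewrite // E inE eqxx.
have comp j : j < size ns -> exists v : nat -> word TG,
  [/\ forall a, a < nth 0 ns j -> exists2 x, (f x).1 = j & V x (v a),
      forall a, a.+1 < nth 0 ns j -> nb (v a) (v a.+1) &
      forall a b, a.+1 < b -> b < nth 0 ns j -> ~~ nb (v a) (v b) /\ ~ raag_eq eG (v a) (v b)].
  move=> js; set n := nth 0 ns j.
  have n0 : 0 < n by have /allP := ns_gt0; apply; apply: mem_nth.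
  have [x00 _] := f_surj _ _ js n0.
  pose x a := odflt x00 [pick y | f y == (j, a)].
  have fx a : a < n -> f (x a) = (j, a).
    move=> aN; rewrite /x; case: pickP => [y /eqP //|].
    by have [y fy] := f_surj _ _ js aN; move=> /(_ y); rewrite fy eqxx.
  have nx a b : a < n -> b < n -> a != b -> x a != x b.
    by move=> aN bN; apply: contraNneq => /(congr1 f); rewrite !fx // => -[->].
  have eLx a b : a < n -> b < n -> a != b -> eL (x a) (x b) = (a.+1 != b) && (b.+1 != a).
    move=> aN bN ab; rewrite eLE ?nx // !fx // /path_forest_adj /= eqxx /=.
    by rewrite negb_or.
  have [] := @induced_path _ nb (raag_eq eG) n (fun a => V (x a)).
  - exact: nb_sym.
  - move=> w s r ws; rewrite /nb; congr negb.
    by apply/cP/cP; rewrite ws.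
  - exact: n0.
  - exact: V_ex.
  - move=> a Q an [w [u ux wE] Qw] HQ s [v vx ->].
    have [_ _ C] := p_pure (x a).
    apply: (C (fun u => Q (cnj (p (x a)).1 (gen u)))) => //.
      by exists u => //; rewrite -wE.
    move=> u' v' us vs uv Qu; case: (eqVneq u' v') => [<- //|nuv].
    apply: (HQ (cnj (p (x a)).1 (gen u'))) => //; [by exists u'|by exists v'|].
    apply/cP; rewrite (comm_conj eG_sym) => /(comm_gen eG_sym eG_irr) [E|E].
      by rewrite E in uv.
    by rewrite E eqxx in nuv.
  (* Without a link all conjugated letters would commute, hence also the two pure elements, against
     [p_clash]. *)
  - move=> a an; apply: NNPP => N.
    have [] : ~ comm eG (cval (p (x a))) (cval (p (x a.+1))).
      by apply: p_clash; rewrite ?nx ?eLx //; lia.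
    apply: (comm_conj_letters eG_sym) => u us; apply: comm_sym.
    apply: (comm_conj_letters eG_sym) => v vs; apply/cP/negPn/negP => C.
    apply: N; exists (cnj (p (x a)).1 (gen u)), (cnj (p (x a.+1)).1 (gen v)).
    by split; [exists u | exists v | rewrite nb_sym].
  - by move=> a b w s ab bn; apply: V_far; rewrite eLx //; lia.
  move=> v [v1 v2 v3]; exists v; split=> // a an.
  by have [i ni Vi] := v1 a an; exists (x i) => //; rewrite fx.
have /fin_all_exists [v Hv] : forall j : 'I_(size ns), _ := fun j => comp j (ltn_ord j).
pose iota x := v (Ordinal (proj1 (f_dom x))) (f x).2.
exists iota.
have home x : exists2 x', (f x').1 = (f x).1 & V x' (iota x).
  have [H _ _] := Hv (Ordinal (proj1 (f_dom x))).
  by have [x' ? ?] := H _ (proj2 (f_dom x)); exists x'.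
have main x y : x != y -> nb (iota x) (iota y) = ~~ eL x y /\ ~ raag_eq eG (iota x) (iota y).
  move=> xy; case: (eqVneq (f x).1 (f y).1) => [E|nE]; last first.
    have [x' xx' Vx] := home x; have [y' yy' Vy] := home y.
    have exy : eL x' y' by apply: eLfst; rewrite xx' yy'.
    have [/negPf -> N] := V_far _ _ _ _ exy Vx Vy.
    by rewrite eLfst.
  have iE z (zE : (f z).1 = (f x).1) : iota z = v (Ordinal (proj1 (f_dom x))) (f z).2.
    by rewrite /iota; congr (v _ _); apply: val_inj.
  rewrite (iE x) // (iE y) //.
  have [_ Hc Hf] := Hv (Ordinal (proj1 (f_dom x))).
  move: (v _) Hc Hf => g /= Hc Hf.
  have [_ dx] := f_dom x; have [_ dy] := f_dom y; rewrite -E in dy.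
  rewrite eLE // /path_forest_adj E eqxx /= negbK.
  have fP w : f w = ((f w).1, (f w).2) by case: (f w).
  have n2 : (f x).2 != (f y).2.
    by apply: contra xy => /eqP E2; apply/eqP/f_inj; rewrite (fP x) (fP y) E E2.
  move: (f x).2 (f y).2 dx dy n2 => a b an bn ab.
  have R a' b' : a' < b' -> b' < nth 0 ns (f x).1 ->
      nb (g a') (g b') = (a'.+1 == b') /\ ~ raag_eq eG (g a') (g b').
    move=> ab' bn'; case: (a'.+1 =P b') => [E2|/eqP E2].
      have := Hc a'; rewrite E2 => /(_ bn') N; split=> // E3.
      by case/negP: N; apply/cP; rewrite E3; apply: comm_refl.
    by have [|/negPf -> //] := Hf a' b' _ bn'; lia.
  case: (ltngtP a b) ab => // ab _.
    by have [-> N] := R a b ab bn; split=> //; lia.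
  have [RE N] := R b a ab an; rewrite nb_sym RE; split; first by lia.
  by move=> E3; apply: N; symmetry.
split; first by move=> x; have [x' _ [u _ ->]] := home x; exists (p x').1, u.
split; first by move=> x y xy; have [_] := main x y xy.
move=> x y xy; have [H N] := main x y xy; split.
  by move=> exy; split=> //; apply/cP; move: H; rewrite exy => /negbFE.
by case=> _ /cP C; apply/negPn; rewrite -H negbK.
Qed.

End Transfer.

(** * From the injective homomorphism to the full embedding *)

Theorem theorem1p3 (TL TG : finType) (eL : rel TL) (eG : rel TG) :
  simple_graph eL -> simple_graph eG ->
  linear_forest (compl_rel eL) ->
  (exists phi : TL -> word TG, injective_raag_hom eL eG phi) ->
  exists iota : TL -> word TG, full_embedding_ext eL eG iota.
Proof.
move=> [eL_sym eL_irr] [eG_sym eG_irr] LF [phi [phi_hom phi_inj]].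
have [m [z [psi [M [M0 zpure zpar psiE psiC]]]]] := clique_form phi eG_sym eG_irr.
pose eB : rel 'I_m := fun c d => (c != d) && commb eG (cval (z c)) (cval (z d)).
have cP := commP eG_sym eG_irr.
have eB_sym : symmetric eB.
  move=> c d; rewrite /eB eq_sym; congr (_ && _).
  by apply/cP/cP; apply: comm_sym.
have eB_irr : irreflexive eB by move=> c; rewrite /eB eqxx.
(* A relation over [eB] maps to one over [eG] under [c |-> cval (z c)], which turns [psi u] into the
   [M]-th power of [phi u]; injectivity of [phi] pulls it back. *)
have psi_inj W : raag_eq eB (hom_ext psi W) [::] ->
    raag_eq eL (hom_ext (fun u => wpow (gen u) M) W) [::].
  have zhom c d : eB c d -> comm eG (cval (z c)) (cval (z d)) by case/andP=> _ /cP.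
  move/(hom_ext_raag zhom); rewrite hom_ext_comp => H.
  apply: phi_inj; rewrite hom_ext_comp; apply: raag_trans H.
  apply: hom_ext_congr => // u; rewrite hom_ext_wpow hom_ext_gen.
  exact: psiE.
have psi_comm i j : eL i j || (i == j) -> forall c d,
    c \in supp (psi i) -> d \in supp (psi j) -> eB c d \/ c = d.
  move=> ij c d ci dj; case: (eqVneq c d) => [|cd]; [by right|left].
  rewrite /eB cd; apply/cP; apply: (psiC i j _ c d ci dj).
  case/orP: ij => [/phi_hom //|/eqP ->]; exact: comm_refl.
have [h Hh] : exists h : TL -> 'I_m, forall x y, x != y ->
    h x != h y /\ eB (h x) (h y) = eL x y.
  have [ns [f [_ [f_inj [f_dom [f_surj fE]]]]]] := LF.
  apply: (clique_embedding M0 eL_sym eL_irr eB_sym eB_irr psi_inj psi_comm f_inj f_dom f_surj).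
  by move=> x y xy; rewrite -fE /compl_rel xy negbK.
(* Distinct roots are not parallel, so commuting ones fall under the second alternative of the
   dichotomy. *)
have far_z c d : eB c d -> far eG (z c).1 (z c).2 (z d).1 (z d).2.
  case/andP=> cd /cP C; have [P|//] := pure_dichotomy eG_sym eG_irr (zpure c) (zpure d) C.
  by case: (zpar d c) => //; rewrite eq_sym.
apply: (@transfer _ _ eL _ eG_sym eG_irr (z \o h)) => //.
- by move=> x; apply: zpure.
- move=> x y xy; apply: far_z; have [|_ ->] := Hh x y => //.
  by apply: contraTneq xy => ->; rewrite eL_irr.
- move=> x y xy /negP exy C; apply: exy; have [hxy <-] := Hh x y xy.
  by rewrite /eB hxy; apply/cP.
Qed.
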